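(* Let $f,g$ be functions with $f(n)\to\infty$, $g(n)=O(f(n)/\ln n)$ and $g(n)=o(\sqrt n)$ as $n\to\infty$. For each $n$ let $\mu=(m_1,\dots,m_t)\vdash n$ be a partition with distinct parts $m_1>\dots>m_t$, such that $t\le g(n)$ and $m_t\ge f(n)$. Fix $a>0$ and, for $\nu\vdash n$, define $R_\nu$ by \[ \langle L_\mu,s_\nu\rangle=\frac{f^\nu}{z_\mu}(1+R_\nu),\qquad z_\mu=m_1\cdots m_t . \] Then for every fixed $q>0$, $\sup\{|R_\nu|:\nu\vdash n,\ \nu_1,\nu'_1\le a\sqrt n\}=o(f(n)^{-q})$ as $n\to\infty$. In particular $\langle L_\mu,s_\nu\rangle\sim f^\nu/z_\mu$ for balanced $\nu$, and $\psi^\mu$ tends to be regular.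
   Context: For $\nu\vdash n$, $f^\nu$ is the number of standard Young tableaux of shape $\nu$, $s_\nu$ the Schur function, $\nu_1,\nu'_1$ the lengths of the first row and first column, $\langle\cdot,\cdot\rangle$ the Hall inner product. For $\lambda=(1^{m_1}2^{m_2}\cdots)\vdash n$, $z_\lambda=\prod_i i^{m_i}m_i!$; let $Z_\lambda\cong\prod_i \mathfrak S_{m_i}[\mathbb Z_i]$ be the centralizer of a permutation of cycle type $\lambda$, where $\mathbb Z_i$ is the cyclic group generated by an $i$-cycle; let $\zeta_i$ be a primitive (faithful) linear character of $\mathbb Z_i$ and $\mathrm{id}_{m_i}[\zeta_i]$ the character of the wreath product $\mathfrak S_{m_i}[\mathbb Z_i]$ obtained from $\zeta_i$ and the trivial character of $\mathfrak S_{m_i}$. The higher Lie character is $\psi^\lambda=\mathrm{Ind}_{Z_\lambda}^{\mathfrak S_n}(\mathrm{id}_{m_1}[\zeta_1]\otimes\mathrm{id}_{m_2}[\zeta_2]\otimes\cdots)$, and $L_\lambda$ is its Frobenius characteristic. A family of partitions $\nu\vdash n$ is balanced if there is a constant $a$ with $\nu_1,\nu'_1\le a\sqrt n$. A sequence of characters tends to be regular if $\langle\rho_n,\chi^{\nu^{(n)}}\rangle/\rho_n(1)\sim f^{\nu^{(n)}}/n!$ for Plancherel-typical (in particular, it suffices: for all balanced) $(\nu^{(n)})$; for $\rho=\psi^\lambda$ this reads $\langle L_\lambda,s_\nu\rangle\sim f^\nu/z_\lambda$. *)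

(* Defs.v *)
From HB Require Import structures.
From mathcomp Require Import all_boot all_order all_algebra all_fingroup.
From mathcomp Require Import all_classical all_reals all_analysis.
From mathcomp Require Import complex.

Set Implicit Arguments.
Unset Strict Implicit.
Unset Printing Implicit Defensive.

Import Order.TTheory GRing.Theory Num.Theory.
Local Open Scope ring_scope.

Definition is_partition (n : nat) (nu : seq nat) : bool :=
  [&& sorted geq nu, all (fun x => 0 < x)%N nu & sumn nu == n].

Definition part_row1 (nu : seq nat) : nat := head 0%N nu.
Definition part_col1 (nu : seq nat) : nat := size nu.

Definition in_diagram (nu : seq nat) (c : nat * nat) : bool :=
  (c.1 < size nu)%N && (c.2 < nth 0 nu c.1)%N.

(* A standard Young tableau of shape nu |- n, given by the position p k of the
   entry k (k = 0..n-1): p is injective into the diagram (hence a bijection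
   onto it, as the diagram has n cells) and entries increase along rows and
   columns (if cell p k is weakly north-west of cell p l then k <= l). *)
Definition is_SYT (n : nat) (nu : seq nat) (p : {ffun 'I_n -> 'I_n * 'I_n}) : bool :=
  [&& injectiveb p,
      [forall k, in_diagram nu ((p k).1 : nat, (p k).2 : nat)] &
      [forall k, forall l,
         (((p k).1 <= (p l).1)%N && ((p k).2 <= (p l).2)%N) ==> (k <= l)%N]].

Definition nSYT (n : nat) (nu : seq nat) : nat := #|[set p : {ffun 'I_n -> 'I_n * 'I_n} | is_SYT nu p]|.

(* Value at x of the permutation character of S_n on ordered set partitions
   (tabloids) with block sizes alpha_0, ..., alpha_{l-1}, i.e. the character of
   Ind_{S_alpha}^{S_n} 1 = the character with Frobenius characteristic
   h_alpha; it is 0 if some alpha_i is negative. *)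
Definition perm_char_tab (n l : nat) (alpha : 'I_l -> int) (x : {perm 'I_n}) : nat :=
  #|[set F : {ffun 'I_n -> 'I_l} |
      [forall k, F (x k) == F k] &&
      [forall i, (#|[set k | F k == i]| : int) == alpha i]]|.

(* The irreducible character chi^nu of S_n (nu |- n), by the Frobenius /
   Jacobi-Trudi determinantal formula  s_nu = det (h_{nu_i - i + j}):
   chi^nu = sum_{w in S_l} sgn(w) * char(h_{(nu_i - i + w(i))_i}),  l = size nu. *)
Definition irr_char (n : nat) (nu : seq nat) (x : {perm 'I_n}) : int :=
  \sum_(w : {perm 'I_(size nu)})
     (-1) ^+ (odd_perm w) *
     (perm_char_tab
        (fun i : 'I_(size nu) => (nth 0 nu i)%:Z - (i : nat)%:Z + (w i : nat)%:Z) x)%:Z.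

Section HigherLie.
Variable R : rcfType.
Local Notation C := (R[i]).

(* sigma is a permutation of cycle type mu (its cycles are the porbits);
   Z_mu is its centralizer in S_n. *)
Definition centralizer_set (n : nat) (sigma : {perm 'I_n}) : {set {perm 'I_n}} :=
  [set z : {perm 'I_n} | (z * sigma == sigma * z)%g].

(* The linear character id[zeta_1] (x) ... (x) id[zeta_t] of Z_mu, for mu with
   distinct parts (so Z_mu = <c_1> x ... x <c_t>, c_i the cycles of sigma).
   omega m is the value of the primitive character zeta of Z_m on the generating
   m-cycle: an element z = c_1^{k_1} ... c_t^{k_t} of Z_mu moves the chosen
   point p_i of the i-th cycle to sigma^{k_i} p_i, and is sent to
   prod_i (omega m_i)^{k_i}. *)
Definition lie_lin_char (n : nat) (sigma : {perm 'I_n}) (omega : nat -> C)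
    (z : {perm 'I_n}) : C :=
  \prod_(O in porbits sigma)
     (if [pick p in O] is Some p
      then omega #|O| ^+ findex sigma p (z p) else 1).

(* The higher Lie character psi^mu = Ind_{Z_mu}^{S_n} (lie_lin_char), by the
   definition of induced class functions. *)
Definition higher_lie_char (n : nat) (sigma : {perm 'I_n}) (omega : nat -> C)
    (x : {perm 'I_n}) : C :=
  #|centralizer_set sigma|%:R^-1 *
  \sum_(y : {perm 'I_n})
     (if (x ^ y)%g \in centralizer_set sigma
      then lie_lin_char sigma omega (x ^ y)%g else 0).

(* <L_mu, s_nu> = <psi^mu, chi^nu>_{S_n} (Hall inner product = inner product
   of class functions via the Frobenius characteristic map; chi^nu is real). *)
Definition lie_schur_coeff (n : nat) (sigma : {perm 'I_n}) (omega : nat -> C)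
    (nu : seq nat) : C :=
  (n`!)%:R^-1 *
  \sum_(x : {perm 'I_n}) higher_lie_char sigma omega x * (irr_char nu x)%:~R.

Definition z_distinct (n : nat) (sigma : {perm 'I_n}) : nat :=
  \prod_(O in porbits sigma) #|O|.

Definition remainder (n : nat) (sigma : {perm 'I_n}) (omega : nat -> C)
    (nu : seq nat) : C :=
  (z_distinct sigma)%:R * lie_schur_coeff sigma omega nu / (nSYT n nu)%:R - 1.

End HigherLie.

(* Main.v *)
(** By Frobenius reciprocity [1 + R_nu] is the sum over the centralizer [Z] of
    [lambda(z) chi(z) / f], where [lambda] is the linear character,
    [chi = chi^nu] and [f = f^nu]; hence [|R_nu|] is at most the sum of
    [|chi(z)| / f] over [z <> 1] in [Z].  It is enough to show
    [|chi(z)| / f <= exp(- supp(z) / 8)] for balanced [nu] and large [n], where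
    [supp(z)] is the number of points moved by [z]: since an element of [Z]
    moves all or none of the points of a cycle, the sum is then at most
    [prod_i (1 + m_i exp(- m_i / 8)) - 1].

    For the decay of character ratios, column orthogonality gives
    [chi(x)^2 <= |C(x)| <= n^(n - supp(x)/2)], while the hook product bound
    [f >= n! / (nu_1 + nu'_1)^n] makes [f] at least [sqrt(n!)] up to an
    exponential factor, so [|chi(x)| / f <= exp(delta n) 2^(- supp(x))] for
    every fixed [delta > 0] and [n] large.  This is useless for small supports,
    but [(chi(z)/f)^j] is the average of [chi / f] over the products of [j]
    random conjugates of [z]; with [j] of order [n / supp(z)] these products
    typically move a positive proportion of the points, which transfers the
    bound to all supports. *)
Require Import Defs.
From HB Require Import structures.
From mathcomp Require Import all_boot all_order all_algebra all_fingroup.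
From mathcomp Require Import all_classical all_reals all_analysis.
From mathcomp Require Import complex.
From mathcomp Require Import all_field all_character.
From mathcomp Require Import ring lra zify.
(* The analysis files shadow the names of the theory of finite sets. *)
From mathcomp Require Import fintype finset.
(* [irr_char] is the character of a partition, not the lemma of MathComp. *)
Import Defs.
From mathcomp Require mpoly.
Import -(notations) mpoly.
Import Order.TTheory GRing.Theory Num.Theory.
Local Open Scope ring_scope.

Set Implicit Arguments.
Unset Strict Implicit.
Unset Printing Implicit Defensive.

(** * Schur functions: the bialternant formula *)

Section Bialternant.
Variables (R : comNzRingType) (N B : nat) (y : 'I_N -> R).

(* The bound [B] on the exponents makes the sum finite; only the degrees
   [m <= B] are meaningful. *)
Definition hsym (m : nat) : R :=
  \sum_(b : {ffun 'I_N -> 'I_B.+1} | (\sum_i b i == m)%N) \prod_i y i ^+ b i.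

Definition geom (c : R) : {poly R} := \poly_(b < B.+1) c ^+ b.

Lemma coef_prod_geom (m : nat) : (\prod_i geom (y i))`_m = hsym m.
Proof.
have -> : \prod_i geom (y i) = \prod_i \sum_(b < B.+1) y i ^+ b *: 'X^b.
  by apply: eq_bigr => i _; rewrite /geom poly_def.
rewrite bigA_distr_bigA /= coef_sum /hsym [RHS]big_mkcond /=.
apply: eq_bigr => b _.
have -> : \prod_i (y i ^+ b i *: 'X^(b i)) =
    (\prod_i y i ^+ b i) *: 'X^(\sum_i b i) :> {poly R}.
  rewrite scaler_prod; congr (_ *: _).
  by elim/big_rec2: _ => [|i n p _ ->]; rewrite ?expr0 // exprD.
rewrite coefZ coefXn eq_sym; case: eqP => _; by rewrite ?mulr1 ?mulr0.
Qed.

Lemma hsym0 : hsym 0 = 1.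
Proof.
rewrite -coef_prod_geom coef0_prod big1 // => i _.
by rewrite coef_poly /= expr0.
Qed.

Lemma geomK (c : R) : (1 - c%:P * 'X) * geom c = 1 - c ^+ B.+1 *: 'X^(B.+1).
Proof.
rewrite /geom poly_def -exprZn.
have -> : \sum_(i < B.+1) c ^+ i *: 'X^i = \sum_(i < B.+1) (c%:P * 'X) ^+ i.
  by apply: eq_bigr => i _; rewrite mul_polyC exprZn.
by rewrite -[in LHS]opprB mulNr -subrX1 opprB mul_polyC.
Qed.

(** The coefficients are the signed elementary symmetric polynomials in the variables other than
    [y i]. *)
Definition codet (i : 'I_N) : {poly R} := \prod_(s | s != i) (1 - (y s)%:P * 'X).

Lemma size_codet (i : 'I_N) : (size (codet i) <= N)%N.
Proof.
apply: leq_trans (size_poly_prod_leq _ _) _.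
have -> : #|(fun s : 'I_N => s != i)| = N.-1.
  by rewrite -[in RHS](card_ord N) (cardC1 i).
have le2 : (\sum_(s | s != i) size (1 - (y s)%:P * 'X)%R <= N.-1 * 2)%N.
  rewrite -[N.-1](_ : #|(fun s : 'I_N => s != i)| = _); last first.
    by rewrite -[in RHS](card_ord N) (cardC1 i).
  rewrite -sum_nat_const; apply: leq_sum => s _.
  apply: leq_trans (size_polyD _ _) _; rewrite size_polyN size_poly1 geq_max /=.
  by rewrite mul_polyC (leq_trans (size_scale_leq _ _)) ?size_polyX.
have N0 : (0 < N)%N := leq_ltn_trans (leq0n i) (ltn_ord i).
rewrite leq_subLR (leq_ltn_trans le2) //.
by rewrite muln2 -addnn ltn_add2l prednK.
Qed.

(** The generating series of the [hsym] is the inverse of the product of all [1 - y s X];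
    multiplication by [codet i] cancels every factor but one and leaves the geometric series of
    [y i]. *)
Lemma codet_hsym (i : 'I_N) (m : nat) : (m <= B)%N ->
  \sum_(r < N) (codet i)`_r * (if (r <= m)%N then hsym (m - r) else 0) = y i ^+ m.
Proof.
move=> leB.
have cM : (codet i * \prod_s geom (y s))`_m = y i ^+ m.
  rewrite (bigD1 i) //= mulrCA -big_split /=.
  under eq_bigr => s _ do rewrite geomK.
  (* The errors due to truncation are all multiples of [X^(B+1)], invisible in degree [m <= B]. *)
  have [Z ->] : exists Z : {poly R},
      \prod_(s < N | s != i) (1 - y s ^+ B.+1 *: 'X^(B.+1)) = 1 + Z * 'X^(B.+1).
    elim/big_rec: _ => [|s p _ [Z ->]]; first by exists 0; rewrite mul0r addr0.
    exists (Z - (y s ^+ B.+1)%:P * (1 + Z * 'X^(B.+1))).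
    by rewrite -mul_polyC; ring.
  rewrite mulrDr mulr1 coefD mulrA coefMXn ltnS leB addr0 coef_poly ltnS leB //.
rewrite -cM coefM.
transitivity (\sum_(r < N + m.+1 | (r < N)%N && (r < m.+1)%N)
   (codet i)`_r * hsym (m - r)).
  rewrite big_andbC /=.
  rewrite -(big_ord_widen_cond _ (fun r => (r < m.+1)%N) (fun r => (codet i)`_r * hsym (m - r))) ?leq_addr //.
  rewrite [RHS]big_mkcond /=; apply: eq_bigr => r _.
  by rewrite ltnS; case: ifP; rewrite ?mulr0.
rewrite -(big_ord_widen_cond _ (fun r => (r < N)%N) (fun r => (codet i)`_r * hsym (m - r))) ?leq_addl //.
rewrite big_mkcond /=; apply: eq_bigr => r _; rewrite -coef_prod_geom.
case: ltnP => // leN; rewrite nth_default ?mul0r //.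
exact: leq_trans (size_codet i) leN.
Qed.

(** By [codet_hsym] every matrix of powers is the product of one fixed matrix [C] with a matrix of
    complete symmetric polynomials. For the exponents [0, ..., N-1] the second factor is
    unitriangular, so [det C] is the Vandermonde determinant. *)
Lemma bialternant (l : 'I_N -> nat) : (forall j, l j <= B)%N -> (N <= B.+1)%N ->
  \det (\matrix_(i < N, j < N) y i ^+ l j) =
  \det (\matrix_(i < N, j < N) y i ^+ j) *
  \det (\matrix_(r < N, j < N) if (r <= l j)%N then hsym (l j - r) else 0).
Proof.
move=> lB NB.
pose H (l : 'I_N -> nat) := \matrix_(r < N, j < N) if (r <= l j)%N then hsym (l j - r) else 0.
pose C := \matrix_(i < N, r < N) (codet i)`_r.
have CH (k : 'I_N -> nat) : (forall j, k j <= B)%N ->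
    \matrix_(i < N, j < N) y i ^+ k j = C *m H k.
  move=> kB; apply/matrixP => i j; rewrite !mxE -(codet_hsym _ (kB j)).
  by apply: eq_bigr => r _; rewrite !mxE.
rewrite (CH l lB) (CH (fun j => j : nat)); last first.
  by move=> j; rewrite -ltnS (leq_trans _ NB).
rewrite !det_mulmx; congr (_ * _).
suff -> : \det (H (fun j => j : nat)) = 1 by rewrite mulr1.
rewrite -det_tr det_trig; last first.
  by apply/is_trig_mxP => i j ij; rewrite !mxE leqNgt ij.
by rewrite big1 // => j _; rewrite !mxE leqnn subnn hsym0.
Qed.

End Bialternant.

(** Compare the coefficients of the monomial with exponents [l] in [bialternant]. On the left only
    the identity permutation produces it, as [l] is injective; on the right [w] comes from the
    Vandermonde determinant, [w'] from the other one, and [A j i] is the exponent of [y i] in the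
    [j]-th complete symmetric factor. *)
Lemma signed_margin_count (N B : nat) (l : 'I_N -> nat) :
  injective l -> (forall j, l j <= B)%N -> (N <= B.+1)%N ->
  \sum_(w : {perm 'I_N}) \sum_(w' : {perm 'I_N}) (-1) ^+ odd_perm w * ((-1) ^+ odd_perm w' *
    #|[set A : {ffun 'I_N -> {ffun 'I_N -> 'I_B.+1}} |
        [forall i, (\sum_j A j i + w i == l i)%N] &&
        [forall j, (\sum_i A j i + w' j == l j)%N]]|%:Z) = 1.
Proof.
move=> injl lB NB.
pose y (i : 'I_N) : mpoly N int := mpolyX int (mnm1 i).
pose mon (k : 'I_N -> nat) := Multinom [tuple k i | i < N].
have monE k : \prod_i y i ^+ k i = mpolyX int (mon k).
  by rewrite mpolyXE_id; apply: eq_bigr => i _; rewrite mnmE.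
have mon_eq k k' : (mon k == mon k') = [forall i, k i == k' i].
  apply/eqP/forallP => [e i|e]; first by rewrite -[k i](mnmE k) -[k' i](mnmE k') -/(mon k) e.
  by apply/mnmP => i; rewrite !mnmE; apply/eqP.
have coefmon k : mcoeff (mon l) (\prod_i y i ^+ k i) = [forall i, k i == l i]%:R.
  by rewrite monE mcoeffX mon_eq.
have := congr1 (mcoeff (mon l)) (bialternant y lB NB).
have -> : mcoeff (mon l) (\det (\matrix_(i, j) y i ^+ l j)) = 1.
  rewrite /determinant raddf_sum /= (bigD1 1%g) //= [X in _ + X]big1 ?addr0.
    rewrite odd_perm1 expr0 mul1r.
    under eq_bigr => i _ do rewrite mxE perm1.
    by rewrite coefmon; case: forallP => // -[] i.
  move=> w w1; rewrite mulr_sign.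
  under eq_bigr => i _ do rewrite mxE.
  suff e0 : mcoeff (mon l) (\prod_(i < N) y i ^+ l (w i)) = 0.
    by case: (odd_perm w); rewrite ?raddfN /= e0 ?oppr0.
  rewrite coefmon; case: forallP => // e; case/eqP: w1.
  by apply/permP => i; rewrite perm1; apply: injl; apply/eqP.
move=> e1; rewrite [RHS]e1; symmetry.
rewrite -[\det (\matrix_(r, j) if _ then _ else _)]det_tr /determinant mulr_suml raddf_sum /=.
apply: eq_bigr => w _; rewrite mulr_sumr raddf_sum /=.
apply: eq_bigr => w' _.
have -> : \prod_i (\matrix_(r, j) (if (r <= l j)%N then hsym B y (l j - r) else 0))^T i (w' i)
  = \sum_(A : {ffun 'I_N -> {ffun 'I_N -> 'I_B.+1}} | [forall j, (\sum_i A j i + w' j == l j)%N])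
     \prod_i y i ^+ (\sum_j A j i).
  transitivity (\prod_j \sum_(b : {ffun 'I_N -> 'I_B.+1} | (\sum_i b i + w' j == l j)%N) \prod_i y i ^+ b i).
    apply: eq_bigr => j _; rewrite !mxE; case: leqP => lj.
      by apply: eq_bigl => b; rewrite -(eqn_add2r (w' j)) subnK.
    rewrite big_pred0 // => b; apply/negbTE; rewrite neq_ltn orbC.
    by rewrite (leq_trans lj) ?leq_addl.
  rewrite bigA_distr_big_dep /=; apply: eq_big => [A|A _].
    by apply/familyP/forallP => h j; exact: h j.
  rewrite exchange_big /=; apply: eq_bigr => i _.
  by rewrite prodrXr.
have sgE (b : bool) (p : mpoly N int) : mcoeff (mon l) ((-1) ^+ b * p) = (-1) ^+ b * mcoeff (mon l) p.
  by rewrite !mulr_sign; case: b; rewrite ?raddfN.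
rewrite -mulrA sgE mulrCA sgE; congr (_ * (_ * _)).
rewrite -[RHS]natz mulr_sumr raddf_sum /= -sum1_card natr_sum big_mkcond [RHS]big_mkcond /=.
apply: eq_bigr => A _; rewrite inE andbC.
case: (forallP (P := fun j => _ == l j)) => //= _; under eq_bigr => i _ do rewrite mxE.
rewrite -big_split /=; under eq_bigr => i _ do rewrite -exprD addnC.
by rewrite coefmon; case: forallP.
Qed.

(** * Frobenius characters of the symmetric group *)

Section FiberCount.
Variables (n : nat) (J : finType).

Definition ffun_perm (G : {ffun 'I_n -> J}) (x : {perm 'I_n}) : {ffun 'I_n -> J} :=
  [ffun k => G (x^-1%g k)].

Lemma ffun_perm_is_action : is_action [set: {perm 'I_n}] ffun_perm.
Proof.
apply: is_total_action => [G|G x y].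
  by apply/ffunP => k; rewrite ffunE invg1 perm1.
by apply/ffunP => k; rewrite !ffunE invMg permM.
Qed.

Canonical ffun_perm_action := Action ffun_perm_is_action.

Lemma ffun_perm_fix (G : {ffun 'I_n -> J}) x :
  (ffun_perm G x == G) = [forall k, G (x k) == G k].
Proof.
apply/eqP/forallP => [e k|e]; first by rewrite -{1}e ffunE permK.
by apply/ffunP => k; rewrite ffunE -(eqP (e (x^-1%g k))) permKV.
Qed.

Lemma card_fiber_perm (G : {ffun 'I_n -> J}) x j :
  #|[set k | ffun_perm G x k == j]| = #|[set k | G k == j]|.
Proof.
rewrite -(card_imset _ (@perm_inj _ x^-1%g)); apply: eq_card => k.
rewrite inE; apply/imsetP/idP => [[k']|e].
  by rewrite inE ffunE => e ->.
by exists (x k); rewrite ?permK // inE ffunE permK.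
Qed.

Lemma card_fiber_count (G : 'I_n -> J) j :
  #|[set k | G k == j]| = count_mem j [tuple G i | i < n].
Proof.
by rewrite cardsE cardE size_filter count_map /= -enumT.
Qed.

(* All functions with prescribed fibre sizes form one orbit of S_n, so this
   is the Cauchy-Frobenius lemma. *)
Lemma sum_fix_fiber (A : J -> nat) : (\sum_j A j)%N = n ->
  (\sum_(x : {perm 'I_n}) #|[set G : {ffun 'I_n -> J} |
     [forall k, G (x k) == G k] && [forall j, #|[set k | G k == j]| == A j]]|)%N = n`!.
Proof.
move=> sumA.
pose S := [set G : {ffun 'I_n -> J} | [forall j, #|[set k | G k == j]| == A j]].
have actsS : [acts [set: {perm 'I_n}]%G, on S | ffun_perm_action].
  apply/actsP => x _ G; rewrite !inE /=; apply: eq_forallb => j.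
  by rewrite card_fiber_perm.
have := Frobenius_Cauchy actsS.
rewrite (_ : #|[set: {perm 'I_n}]%G| = n`!); last by rewrite /= cardsT card_Sn.
pose s := flatten [seq nseq (A j) j | j <- enum J].
have cs j : count_mem j s = A j.
  rewrite count_flatten -map_comp sumnE big_map big_enum /= (bigD1 j) //=.
  rewrite count_nseq /= eqxx mul1n big1 ?addn0 // => i /negbTE ij.
  by rewrite count_nseq /= ij.
have szs : size s == n.
  rewrite size_flatten /shape -map_comp sumnE big_map big_enum /= -[X in _ == X]sumA.
  by apply/eqP; apply: eq_bigr => j _; rewrite size_nseq.
have permS G : G \in S -> perm_eq [tuple G i | i < n] s.
  rewrite inE => /forallP e; apply/allP => j _ /=.
  by rewrite -card_fiber_count cs.
have [G0 SG0] : exists G0, G0 \in S.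
  exists [ffun k => tnth (Tuple szs) k]; rewrite inE; apply/forallP => j.
  rewrite card_fiber_count -(cs j); apply/eqP; congr (count_mem j _).
  apply: (@eq_from_nth _ j) => [|i]; rewrite size_tuple ?(eqP szs) // => ltin.
  by rewrite -(tnth_nth j _ (Ordinal ltin)) tnth_mktuple ffunE (tnth_nth j).
have -> : [set orbit ffun_perm_action [set: {perm 'I_n}]%G G | G in S] =
    [set orbit ffun_perm_action [set: {perm 'I_n}]%G G0].
  apply/setP => O; rewrite inE; apply/imsetP/eqP => [[G SG ->]|->]; last by exists G0.
  apply/orbit_eqP.
  have /tuple_permP[p ep] : perm_eq [tuple G i | i < n] [tuple G0 i | i < n].
    by rewrite (perm_trans (permS _ SG)) // perm_sym permS.
  apply/orbitP; exists (p^-1)%g; rewrite ?inE //=.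
  apply/ffunP => k; rewrite ffunE invgK.
  have /(congr1 (fun t => tnth t k)) := val_inj ep.
  by rewrite !tnth_mktuple.
rewrite cards1 mul1n => <-; apply: eq_big => [x|x _]; first by rewrite inE.
apply: eq_card => G; rewrite !inE /= andbC; congr (_ && _).
by rewrite -ffun_perm_fix sub1set inE.
Qed.
End FiberCount.

(** * Norm of the Frobenius characters *)

Section FrobeniusCharacter.
Variables (n N : nat).
Implicit Types (l : 'I_N -> nat) (x : {perm 'I_n}).

Definition tab_count l (w : {perm 'I_N}) x : nat :=
  #|[set F : {ffun 'I_n -> 'I_N} |
      [forall k, F (x k) == F k] && [forall i, #|[set k | F k == i]| + w i == l i]%N]|.

(** The character whose Frobenius characteristic is the determinant of the [h] with indices
    [l i - j]. *)
Definition frob_char l x : int :=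
  \sum_(w : {perm 'I_N}) (-1) ^+ odd_perm w * (tab_count l w x)%:Z.

Lemma card_fiber_proj1 (I J : finType) (G : 'I_n -> I * J) i :
  #|[set k | (G k).1 == i]| = (\sum_j #|[set k | G k == (i, j)]|)%N.
Proof.
rewrite -sum1_card (partition_big (fun k => (G k).2) xpredT) //=.
apply: eq_bigr => j _; rewrite -sum1_card; apply: eq_bigl => k.
by rewrite !inE; case: (G k).
Qed.

Lemma card_fiber_proj2 (I J : finType) (G : 'I_n -> I * J) j :
  #|[set k | (G k).2 == j]| = (\sum_i #|[set k | G k == (i, j)]|)%N.
Proof.
rewrite -sum1_card (partition_big (fun k => (G k).1) xpredT) //=.
apply: eq_bigr => i _; rewrite -sum1_card; apply: eq_bigl => k.
by rewrite !inE andbC; case: (G k).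
Qed.

(** A pair of invariant functions is one invariant function into the product. Sort these by the
    matrix of fibre sizes: the margins are prescribed, and each matrix contributes [n!] by
    [sum_fix_fiber]. *)
Lemma sum_tab_count_mul (B : nat) l l' (w w' : {perm 'I_N}) : (n <= B)%N ->
  (\sum_i l i = n + \sum_(i < N) i)%N ->
  (\sum_x tab_count l w x * tab_count l' w' x = n`! *
    #|[set A : {ffun 'I_N -> {ffun 'I_N -> 'I_B.+1}} |
        [forall i, (\sum_j A j i + w i == l i)%N] &&
        [forall j, (\sum_i A j i + w' j == l' j)%N]]|)%N.
Proof.
move=> nB suml.
pose AS := [set A : {ffun 'I_N -> {ffun 'I_N -> 'I_B.+1}} |
        [forall i, (\sum_j A j i + w i == l i)%N] &&
        [forall j, (\sum_i A j i + w' j == l' j)%N]].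
pose T x (A : {ffun 'I_N -> {ffun 'I_N -> 'I_B.+1}}) :=
  #|[set G : {ffun 'I_n -> 'I_N * 'I_N} |
     [forall k, G (x k) == G k] && [forall p, #|[set k | G k == p]| == A p.2 p.1]]|.
have step x : (tab_count l w x * tab_count l' w' x = \sum_(A in AS) T x A)%N.
  rewrite /tab_count -cardsX.
  (* The matrix of fibre sizes, column index first; [inord] loses nothing because a fibre has at
     most [n <= B] elements. *)
  pose ty (G : {ffun 'I_n -> 'I_N * 'I_N}) : {ffun 'I_N -> {ffun 'I_N -> 'I_B.+1}} :=
    [ffun j => [ffun i => inord #|[set k | G k == (i, j)]|]].
  have tyE G i j : ty G j i = #|[set k | G k == (i, j)]| :> nat.
    rewrite !ffunE inordK // ltnS (leq_trans _ nB) //.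
    by rewrite -[X in (_ <= X)%N](card_ord n) max_card.
  pose GS := [set G : {ffun 'I_n -> 'I_N * 'I_N} | [forall k, G (x k) == G k] && (ty G \in AS)].
  pose pr (G : {ffun 'I_n -> 'I_N * 'I_N}) :=
    ([ffun k => (G k).1] : {ffun 'I_n -> 'I_N}, [ffun k => (G k).2] : {ffun 'I_n -> 'I_N}).
  transitivity #|GS|.
    have pr_inj : injective pr.
      move=> G G' [/ffunP e1 /ffunP e2]; apply/ffunP => k.
      have := e1 k; have := e2 k; rewrite !ffunE.
      by case: (G k) (G' k) => ? ? [? ?] /= -> ->.
    rewrite -(card_imset _ pr_inj); apply: eq_card => -[F F'].
    rewrite !inE /=; apply/idP/imsetP.
      case/andP=> /andP[/forallP xF /forallP tF] /andP[/forallP xF' /forallP tF'].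
      exists [ffun k => (F k, F' k)]; last first.
        by congr (_, _); apply/ffunP => k; rewrite !ffunE.
      rewrite !inE; apply/and3P; split.
      - by apply/forallP => k; rewrite !ffunE (eqP (xF k)) (eqP (xF' k)).
      - apply/forallP => i; under eq_bigr => j _ do rewrite tyE.
        rewrite -card_fiber_proj1 -(eqP (tF i)); apply/eqP; congr (_ + _)%N.
        by apply: eq_card => k; rewrite !inE ffunE.
      apply/forallP => i; under eq_bigr => j _ do rewrite tyE.
      rewrite -card_fiber_proj2 -(eqP (tF' i)); apply/eqP; congr (_ + _)%N.
      by apply: eq_card => k; rewrite !inE ffunE.
    case=> G; rewrite !inE => /and3P[/forallP xG /forallP t1 /forallP t2] [-> ->].
    apply/andP; split; apply/andP; split; apply/forallP => i; rewrite ?ffunE ?(eqP (xG _)) //.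
      rewrite -(eqP (t1 i)); under [X in _ == (X + _)%N]eq_bigr => j _ do rewrite tyE.
      rewrite -card_fiber_proj1; apply/eqP; congr (_ + _)%N.
      by apply: eq_card => k; rewrite !inE ffunE.
    rewrite -(eqP (t2 i)); under [X in _ == (X + _)%N]eq_bigr => j _ do rewrite tyE.
    rewrite -card_fiber_proj2; apply/eqP; congr (_ + _)%N.
    by apply: eq_card => k; rewrite !inE ffunE.
  rewrite -sum1_card (partition_big ty (mem AS)) /=; last first.
    by move=> G; rewrite inE => /andP[].
  apply: eq_bigr => A SA; rewrite /T -sum1_card; apply: eq_bigl => G.
  rewrite !inE; apply/andP/andP => [[/andP[xG _] /eqP <-]|[xG /forallP tG]].
    by split=> //; apply/forallP => -[i j] /=; rewrite tyE.
  have e : ty G = A.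
    apply/ffunP => j; apply/ffunP => i; apply/val_inj; rewrite /= tyE.
    exact: eqP (tG (i, j)).
  by rewrite xG e eqxx; move: SA; rewrite inE.
under eq_bigr => x _ do rewrite step.
rewrite exchange_big /= -/AS mulnC -sum_nat_const; apply: eq_bigr => A.
rewrite inE => /andP[/forallP rA _].
apply: (sum_fix_fiber (A := fun p : 'I_N * 'I_N => A p.2 p.1 : nat)).
rewrite -(pair_bigA _ (fun i j => A j i : nat)) /=.
apply/eqP; rewrite -(eqn_add2r (\sum_(i < N) i)) -suml.
rewrite [X in (_ + X)%N](reindex_inj (@perm_inj _ w)) -big_split /=.
by apply/eqP; apply: eq_bigr => i _; rewrite (eqP (rA i)).
Qed.

(** Expanding both determinants and summing over [x] gives [n!] times the signed count of
    [signed_margin_count]. The auxiliary [B] only has to dominate [n], [N - 1] and all [l j]. *)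
Lemma norm_frob_char l : injective l -> (\sum_i l i = n + \sum_(i < N) i)%N ->
  \sum_x frob_char l x * frob_char l x = (n`!)%:Z.
Proof.
move=> injl suml; pose B := (n + N + \sum_i l i)%N.
have lB j : (l j <= B)%N by rewrite /B (bigD1 j) //= addnA addnAC leq_addl.
have nB : (n <= B)%N by rewrite /B -addnA leq_addr.
have NB : (N <= B.+1)%N by rewrite /B -addnA addnCA leqW ?leq_addr.
rewrite -[RHS]mulr1 -(signed_margin_count injl lB NB) mulr_sumr.
transitivity (\sum_(w : {perm 'I_N}) \sum_(w' : {perm 'I_N}) \sum_x
    (-1) ^+ odd_perm w * ((-1) ^+ odd_perm w' * (tab_count l w x * tab_count l w' x)%:Z)).
  under [RHS]eq_bigr => w _ do rewrite exchange_big /=.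
  rewrite [RHS]exchange_big /=; apply: eq_bigr => x _.
  rewrite mulr_suml; apply: eq_bigr => w _.
  rewrite mulr_sumr; apply: eq_bigr => w' _.
  by rewrite PoszM mulrACA !mulrA.
apply: eq_bigr => w _; rewrite mulr_sumr; apply: eq_bigr => w' _.
rewrite -!mulr_sumr [RHS]mulrCA; congr (_ * _); rewrite mulrCA; congr (_ * _).
by rewrite -PoszM -(sum_tab_count_mul _ _ _ nB suml) -!natz natr_sum; under eq_bigr do rewrite natz.
Qed.
End FrobeniusCharacter.

(* By Schur's lemma the operator sum_y rho(z^y) is scalar; compare traces. *)
Lemma irr_mul_class_average (gT : finGroupType) (G : {group gT}) (i : Iirr G) x z :
  x \in G -> z \in G ->
  #|G|%:R * ('chi_i x * 'chi_i z) = 'chi_i 1%g * \sum_(y in G) 'chi_i (x * z ^ y)%g.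
Proof.
move=> Gx Gz; set rG := 'Chi_i.
have chiE g : g \in G -> 'chi_i g = \tr (rG g) by move=> Gg; rewrite -irrRepr cfunE Gg.
pose E := \sum_(y in G) rG (z ^ y)%g.
have absG : mx_absolutely_irreducible rG.
  exact: groupC (socle_irr _).
have centE : centgmx rG E.
  apply/centgmxP => g Gg; rewrite /E mulmx_suml mulmx_sumr.
  rewrite [RHS](reindex_acts 'R _ Gg) /=; last exact/actsP/(fun a Ga b => groupMr b Ga).
  apply: eq_bigr => y Gy; rewrite -!repr_mxM ?groupJ ?groupM //.
  by rewrite conjgM conjgC.
have [a Ea] := is_scalar_mxP (mx_abs_irr_cent_scalar absG centE).
have trE : #|G|%:R * 'chi_i z = a * 'chi_i 1%g.
  rewrite [in RHS]chiE // repr_mx1 -mxtraceZ scalemx1 -Ea.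
  rewrite /E raddf_sum /= mulr_natl -sumr_const; apply: eq_bigr => y Gy.
  by rewrite -chiE ?groupJ // cfunJ.
have trxE : \sum_(y in G) 'chi_i (x * z ^ y)%g = a * 'chi_i x.
  rewrite [in RHS]chiE // -mxtraceZ -mul_mx_scalar -Ea mulmx_sumr raddf_sum /=.
  apply: eq_bigr => y Gy; have Gzy := groupJ Gz Gy.
  by rewrite (chiE _ (groupM Gx Gzy)) (repr_mxM rG Gx Gzy).
by rewrite trxE mulrCA trE mulrCA [RHS]mulrCA; congr (_ * _); exact: mulrC.
Qed.

(** * Permutation characters *)

Section PermutationCharacter.
Variables (gT : finGroupType) (T : finType) (to : {action gT &-> T}).
Variable S : {set T}.
Hypothesis actsS : [acts [set: gT], on S | to].

Definition fix_mx (x : gT) : 'M[algC]_#|S| :=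
  \matrix_(i, j) (to (enum_val i) x == enum_val j)%:R.

Lemma fix_mx_repr : mx_repr [set: gT] fix_mx.
Proof.
split=> [|x y _ _]; apply/matrixP => i j.
  by rewrite !mxE act1 (inj_eq enum_val_inj).
rewrite !mxE.
have Sx : to (enum_val i) x \in S by rewrite (acts_act actsS) ?inE ?enum_valP.
rewrite (bigD1 (enum_rank_in Sx (to (enum_val i) x))) //= big1 => [|k]; rewrite !mxE.
  by rewrite addr0 enum_rankK_in // eqxx mul1r actM.
move=> kx; case: eqP => [e|]; last by rewrite mul0r.
by case/eqP: kx; apply: enum_val_inj; rewrite enum_rankK_in.
Qed.

Definition fix_cfun : 'CF([set: gT]) := cfRepr (MxRepresentation fix_mx_repr).

Lemma fix_cfunE x : fix_cfun x = #|'Fix_(S | to)[x]%g|%:R.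
Proof.
rewrite cfunE inE mulr1n /mxtrace -[in RHS]sum1_card natr_sum.
transitivity (\sum_(i < #|S|) (to (enum_val i) x == enum_val i)%:R : algC).
  by apply: eq_bigr => i _; rewrite mxE.
rewrite -(big_enum_val (fun y => (to y x == y)%:R : algC)) [RHS]big_mkcond [LHS]big_mkcond /=.
apply: eq_bigr => y _; rewrite in_setI (sameP afix1P eqP).
by case: (y \in S); case: eqP.
Qed.

End PermutationCharacter.

(** * Irreducibility up to sign, and its consequences *)

Section FrobeniusIrreducible.
Variables (n N : nat) (l : 'I_N -> nat).
Local Notation G := [set: {perm 'I_n}].

Definition tab_set (w : {perm 'I_N}) : {set {ffun 'I_n -> 'I_N}} :=
  [set F : {ffun 'I_n -> 'I_N} | [forall i, #|[set k | F k == i]| + w i == l i]%N].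

Lemma acts_tab_set w : [acts G, on tab_set w | @ffun_perm_action n 'I_N].
Proof.
apply/actsP => x _ F; rewrite !inE /=; apply: eq_forallb => i.
by rewrite card_fiber_perm.
Qed.

Definition frob_cfun : 'CF(G) :=
  \sum_(w : {perm 'I_N}) (-1) ^+ odd_perm w *: fix_cfun (acts_tab_set w).

Lemma frob_cfunE x : frob_cfun x = (frob_char l x)%:~R.
Proof.
rewrite sum_cfunE rmorph_sum /=; apply: eq_bigr => w _.
rewrite cfunE fix_cfunE rmorphM /= rmorph_sign; congr (_ * _%:R).
apply: eq_card => F; rewrite in_setI (sameP afix1P eqP) /= ffun_perm_fix.
by rewrite !inE andbC.
Qed.

Hypothesis injl : injective l.
Hypothesis suml : (\sum_i l i = n + \sum_(i < N) i)%N.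

(** A virtual character of norm one is an irreducible character up to sign. The sign stays
    undetermined here; the consequences below are quadratic or in absolute value, so it cancels. *)
Lemma frob_cfun_irr : exists (b : bool) (i : Iirr G), frob_cfun = (-1) ^+ b *: 'chi_i.
Proof.
apply: vchar_norm1P.
  apply: rpred_sum => w _; rewrite scaler_sign; case: (odd_perm w).
    by rewrite rpredN char_vchar ?cfRepr_char.
  by rewrite char_vchar ?cfRepr_char.
have n0 : (n`!)%:R != 0 :> algC by rewrite pnatr_eq0 -lt0n fact_gt0.
rewrite cfdotE cardsT card_Sn; apply: (mulfI n0); rewrite mulVKf // mulr1.
transitivity ((n`!)%:Z%:~R : algC); last by rewrite -pmulrn.
rewrite -(norm_frob_char injl suml) rmorph_sum /=.
apply: eq_big => [x|x _]; first by rewrite inE.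
by rewrite !frob_cfunE rmorphM /= conj_Creal // Rreal_int.
Qed.

Lemma frob_char_average (x z : {perm 'I_n}) :
  (n`!)%:Z * (frob_char l x * frob_char l z) =
  frob_char l (1%g : {perm 'I_n}) * \sum_y frob_char l (x * z ^ y)%g.
Proof.
have [b [i e]] := frob_cfun_irr.
apply: (@intr_inj algC); rewrite !rmorphM /= -!frob_cfunE [X in _ = _ * X]rmorph_sum /=.
under eq_bigr => y _ do rewrite -frob_cfunE e cfunE.
have scale_both (s m a1 a2 c d : algC) :
    m * (a1 * a2) = c * d -> m * (s * a1 * (s * a2)) = s * c * (s * d).
  by move=> h; rewrite (mulrACA s a1) [LHS]mulrCA h mulrACA.
rewrite e !cfunE -mulr_sumr; apply: scale_both.
have := irr_mul_class_average i (in_setT x) (in_setT z).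
rewrite cardsT card_Sn pmulrn => ->; congr (_ * _).
by apply: eq_bigl => y; rewrite inE.
Qed.

Lemma frob_char_le1 (x : {perm 'I_n}) :
  `|frob_char l x| <= `|frob_char l (1%g : {perm 'I_n})|.
Proof.
have [b [i e]] := frob_cfun_irr.
rewrite -(ler_int algC) !intr_norm -!frob_cfunE e !cfunE !normrM ler_wpM2l //.
by rewrite (le_trans (char1_ge_norm _ (character.irr_char i))) // ger0_norm ?char1_ge0 ?character.irr_char.
Qed.

(** Column orthogonality: the square is one term of the sum over all irreducible characters, which
    equals the order of the centralizer. *)
Lemma frob_char_sqr_le (x : {perm 'I_n}) : frob_char l x ^+ 2 <= #|'C[x]%g|%:Z.
Proof.
have [b [i e]] := frob_cfun_irr.
rewrite -(ler_int algC) -pmulrn.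
have xG : x \in [set: {perm 'I_n}] by rewrite inE.
have := second_orthogonality_relation x xG.
rewrite class_refl mulr1n setTI => <-.
have real_frob : ((frob_char l x)%:~R : algC) \is Num.real by rewrite Rreal_int.
have -> : ((frob_char l x) ^+ 2)%:~R = `|'chi_i x| ^+ 2 :> algC.
  rewrite rmorphXn /= -real_normK //; congr (_ ^+ 2).
  by rewrite -frob_cfunE e cfunE normrM normr_sign mul1r.
rewrite normCK (bigD1 i) //= lerDl sumr_ge0 // => j _.
by rewrite -normCK exprn_ge0.
Qed.
End FrobeniusIrreducible.

(** * Degrees *)

Section Tableaux.
Variables (M N : nat).
Hypothesis NM : (N <= M)%N.
Local Notation cell := ('I_M * 'I_M)%type.
Implicit Types (f : nat -> nat).

(** Row lengths are a function on all of [nat] and cells lie in a fixed [M] by [M] box, so that the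
    type of cells does not change when a box is removed. *)
Definition shape f (m : nat) : Prop :=
  [/\ {homo f : i j / (i <= j)%N >-> (j <= i)%N}, (forall i, f i <= M)%N,
      f N = 0%N & (\sum_(i < N) f i)%N = m].

Definition in_shape f (c : cell) : bool := (c.2 < f c.1)%N.

Definition is_tableau (m : nat) f (p : {ffun 'I_m -> cell}) : bool :=
  [&& injectiveb p, [forall k, in_shape f (p k)] &
      [forall k, forall l,
         (((p k).1 <= (p l).1)%N && ((p k).2 <= (p l).2)%N) ==> (k <= l)%N]].

Definition num_tableaux (m : nat) f : nat := #|[set p | @is_tableau m f p]|.

Definition remove_box f (i : nat) : nat -> nat := fun j => (f j - (j == i))%N.

Lemma shape_lt f m i j : shape f m -> (j < f i)%N -> (i < N)%N.
Proof.
case=> df _ f0 _; case: (ltnP i N) => // /df; rewrite f0 leqn0 => /eqP ->.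
by rewrite ltn0.
Qed.

Lemma card_shape f m : shape f m -> #|[set c | in_shape f c]| = m.
Proof.
move=> sh; have [_ fM _ <-] := sh.
rewrite -sum1_card (eq_bigl (fun c => in_shape f c)); last by move=> c; rewrite inE.
rewrite -(pair_big_dep xpredT (fun r c : 'I_M => (c < f r)%N) (fun _ _ => 1%N)) /=.
rewrite (big_ord_widen M f NM) [RHS]big_mkcond /=; apply: eq_bigr => r _.
rewrite -(big_ord_widen M (fun _ => 1%N) (fM r)) sum1_card card_ord.
case: ltnP => // leN; have [df _ f0 _] := sh.
by apply/eqP; rewrite -leqn0 -f0 df.
Qed.

Lemma tableau_onto f m p c : shape f m -> is_tableau f p -> in_shape f c ->
  exists k : 'I_m, p k = c.
Proof.
move=> sh /and3P[/injectiveP injp /forallP inp _] fc.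
have : [set p k | k : 'I_m] = [set c | in_shape f c].
  apply/eqP; rewrite eqEcard; apply/andP; split.
    by apply/subsetP => _ /imsetP[k _ ->]; rewrite inE.
  by rewrite (card_shape sh) card_imset // card_ord.
move/setP/(_ c); rewrite inE fc => /imsetP[k _ ->].
by exists k.
Qed.

(** The last entry occupies a corner: any cell weakly south-east of it holds some entry, which is at
    least as large and therefore the same. *)
Lemma tableau_last f m (p : {ffun 'I_m.+1 -> cell}) : shape f m.+1 -> is_tableau f p ->
  (f (p ord_max).1.+1 <= (p ord_max).2)%N /\ (p ord_max).2.+1 = f (p ord_max).1.
Proof.
move=> sh tp; have [_ fM _ _] := sh.
have /and3P[injp /forallP inp /forallP ordp] := tp.
have last_max c : in_shape f c -> ((p ord_max).1 <= c.1)%N ->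
    ((p ord_max).2 <= c.2)%N -> c = p ord_max.
  move=> fc le1 le2; have [k pk] := tableau_onto sh tp fc.
  have := forallP (ordp ord_max) k; rewrite pk le1 le2 /= => lek.
  rewrite -pk; congr (p _); apply/eqP.
  by rewrite -val_eqE /= eqn_leq lek andbT -ltnS.
have inm : ((p ord_max).2 < f (p ord_max).1)%N := inp ord_max.
split.
  rewrite leqNgt; apply/negP => lt.
  have rM : ((p ord_max).1.+1 < M)%N by rewrite (leq_trans (shape_lt sh lt)).
  have := last_max (Ordinal rM, (p ord_max).2) lt (leqnSn _) (leqnn _).
  by move/(congr1 (fun c : cell => c.1 : nat)) => /esym /n_Sn.
apply/eqP; rewrite eqn_leq inm /= leqNgt; apply/negP => lt.
have cM : ((p ord_max).2.+1 < M)%N by rewrite (leq_trans lt).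
have := last_max ((p ord_max).1, Ordinal cM) lt (leqnn _) (leqnSn _).
by move/(congr1 (fun c : cell => c.2 : nat)) => /esym /n_Sn.
Qed.

Lemma remove_box_shape f m i : shape f m.+1 -> (f i.+1 < f i)%N -> shape (remove_box f i) m.
Proof.
move=> sh corner; have iN := shape_lt sh corner; have [df fM f0 sf] := sh; split.
- move=> j k jk; rewrite /remove_box.
  have := df _ _ jk; case: (k =P i) => [->|ki]; case: (j =P i) => [ji|ji] //=; try lia.
  move=> _; have : (f k <= f i.+1)%N by apply: df; lia.
  by rewrite ji; lia.
- by move=> j; rewrite /remove_box (leq_trans (leq_subr _ _)).
- by rewrite /remove_box f0.
apply: succn_inj; rewrite -sf (bigD1 (Ordinal iN)) //= [in RHS](bigD1 (Ordinal iN)) //=.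
rewrite /remove_box eqxx -addSn subn1 prednK ?(leq_ltn_trans _ corner) //.
congr (_ + _)%N; apply: eq_bigr => j /negbTE ji.
by rewrite (_ : (j == i :> nat) = false) ?subn0.
Qed.

(** Branching rule: deleting the last entry is a bijection, with inverse [ext], which puts it back
    at the end of row [r]. *)
Lemma num_tableauxS f m : shape f m.+1 ->
  num_tableaux m.+1 f =
  (\sum_(i < N | f i.+1 < f i) num_tableaux m (remove_box f i))%N.
Proof.
move=> sh; have [df fM f0 _] := sh.
have cornerN r : (f r.+1 < f r)%N -> (r < N)%N by apply: shape_lt sh.
have -> : (\sum_(i < N | f i.+1 < f i) num_tableaux m (remove_box f i) =
    \sum_(r < M | f r.+1 < f r) num_tableaux m (remove_box f r))%N.
  rewrite (big_ord_widen_cond _ (fun i => f i.+1 < f i)%N (fun i => num_tableaux m (remove_box f i)) NM).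
  by apply: eq_bigl => r; case: ltnP => // /cornerN ->.
rewrite [LHS]/num_tableaux -sum1_card (partition_big (fun p : {ffun 'I_m.+1 -> cell} => (p ord_max).1) xpredT) //=.
rewrite [RHS]big_mkcond /=; apply: eq_bigr => r _.
under eq_bigl => p do rewrite inE.
case: ifP => corner; last first.
  rewrite big_pred0 // => p; apply/negP => /andP[tp /eqP pr].
  have [le e] := tableau_last sh tp.
  by rewrite -pr -e ltnS le in corner.
have cM : ((f r).-1 < M)%N by rewrite prednK ?fM // (leq_ltn_trans _ corner).
have fr : (f r).-1.+1 = f r by rewrite prednK ?(leq_ltn_trans _ corner).
pose c0 : cell := (r, Ordinal cM).
pose ext (p' : {ffun 'I_m -> cell}) : {ffun 'I_m.+1 -> cell} :=
  [ffun k => if unlift ord_max k is Some k' then p' k' else c0].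
have ext_lift p' k : ext p' (lift ord_max k) = p' k by rewrite ffunE liftK.
have ext_max p' : ext p' ord_max = c0 by rewrite ffunE unlift_none.
have ext_inj : injective ext.
  by move=> p1 p2 e; apply/ffunP => k; rewrite -!ext_lift e.
rewrite sum1_card /num_tableaux -(card_imset _ ext_inj); apply: eq_card => p.
rewrite unfold_in; apply/andP/imsetP => [[tp /eqP pr]|[p']].
  have [_ e] := tableau_last sh tp.
  have pmax : p ord_max = c0.
    rewrite [p ord_max]surjective_pairing pr; congr (_, _); apply/val_inj => /=.
    by rewrite -pr -e.
  exists [ffun k => p (lift ord_max k)]; last first.
    apply/ffunP => k; rewrite ffunE; case: unliftP => [k' ->|->]; by rewrite ?ffunE.
  have /and3P[/injectiveP injp /forallP inp /forallP ordp] := tp.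
  rewrite inE; apply/and3P; split.
  - by apply/injectiveP => k1 k2; rewrite !ffunE => /injp /lift_inj.
  - apply/forallP => k; rewrite /in_shape /remove_box ffunE.
    have := inp (lift ord_max k); rewrite /in_shape.
    case: eqP => [er|_]; last by rewrite subn0.
    rewrite er subn1 -{1}fr ltnS leq_eqVlt => /orP[/eqP ec|//].
    have : p (lift ord_max k) = p ord_max.
      rewrite pmax [p _]surjective_pairing; congr (_, _); apply/val_inj => //=.
    by move/injp/eqP; rewrite eq_sym (negbTE (neq_lift _ _)).
  - apply/forallP => k1; apply/forallP => k2; rewrite !ffunE.
    by have := forallP (ordp (lift ord_max k1)) (lift ord_max k2); rewrite !lift_max.
rewrite inE => /and3P[/injectiveP injp /forallP inp /forallP ordp] ->.
split; last by rewrite ext_max.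
have inp' k : ((p' k).2 < f (p' k).1)%N && (p' k != c0).
  have := inp k; rewrite /in_shape /remove_box => lt.
  rewrite (leq_trans lt) ?leq_subr //; apply/eqP => e.
  by move: lt; rewrite e /= eqxx subn1 ltnn.
apply/and3P; split.
- apply/injectiveP => k1 k2; case: (unliftP ord_max k1) => [k1' ->|->];
    case: (unliftP ord_max k2) => [k2' ->|->]; rewrite ?ext_lift ?ext_max //.
  + by move/injp ->.
  + by move=> e; have /andP[_] := inp' k1'; rewrite e eqxx.
  + by move=> e; have /andP[_] := inp' k2'; rewrite -e eqxx.
- apply/forallP => k; rewrite /in_shape; case: (unliftP ord_max k) => [k' ->|->].
    by rewrite ext_lift; have /andP[] := inp' k'.
  by rewrite ext_max /= -{2}fr.
apply/forallP => k1; apply/forallP => k2; apply/implyP.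
case: (unliftP ord_max k2) => [k2' ->|->]; last first.
  by move=> _; exact: leq_ord.
case: (unliftP ord_max k1) => [k1' ->|->].
  rewrite !ext_lift !lift_max; exact: (implyP (forallP (ordp k1') k2')).
rewrite ext_lift ext_max /= => /andP[ler lec].
have := inp k2'; rewrite /in_shape /remove_box.
case: eqP => [er|ner]; first by rewrite er subn1 ltnNge lec.
rewrite subn0 => lt; have : (f (p' k2').1 <= f r.+1)%N.
  apply: df; rewrite ltn_neqAle ler andbT eq_sym; exact/eqP.
move=> le; have := leq_ltn_trans lec (leq_trans lt le).
by rewrite ltnNge -ltnS fr corner.
Qed.
End Tableaux.

(** * Degrees by the branching rule *)

Section FrobeniusDegree.
Variable N : nat.
Implicit Types (l : 'I_N -> nat) (w t : {perm 'I_N}).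

Lemma tab_count1 n l w : tab_count l w (1%g : {perm 'I_n}) =
  #|[set F : {ffun 'I_n -> 'I_N} | [forall i, #|[set k | F k == i]| + w i == l i]%N]|.
Proof.
apply: eq_card => F; rewrite !inE; case: forallP => // -[] k.
by rewrite perm1.
Qed.

Lemma eq_frob_char n l l' (x : {perm 'I_n}) : l =1 l' -> frob_char l x = frob_char l' x.
Proof.
move=> e; apply: eq_bigr => w _; congr (_ * _%:Z); apply: eq_card => F.
by rewrite !inE; congr (_ && _); apply: eq_forallb => i; rewrite e.
Qed.

(** The analogue of a determinant with two equal rows: relabelling the values by [t] shows that the
    degree is its own negative. *)
Lemma frob_char1_swap n l t : (forall i, l (t i) = l i) -> odd_perm t ->
  frob_char l (1%g : {perm 'I_n}) = 0.
Proof.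
move=> lt odt; suff e : frob_char l (1%g : {perm 'I_n}) = - frob_char l (1%g : {perm 'I_n}).
  by set c := frob_char _ _ in e *; lia.
rewrite {1}/frob_char (reindex_inj (mulgI t)) /= -sumrN; apply: eq_bigr => w _.
rewrite odd_permM odt signr_addb expr1 !mulN1r mulNr; congr (- (_ * _%:Z)).
rewrite !tab_count1.
pose h (F : {ffun 'I_n -> 'I_N}) : {ffun 'I_n -> 'I_N} := [ffun k => t (F k)].
have h_inj : injective h.
  by move=> F F' /ffunP e; apply/ffunP => k; have := e k; rewrite !ffunE => /perm_inj.
have hE F i : #|[set k | h F k == t i]| = #|[set k | F k == i]|.
  by apply: eq_card => k; rewrite !inE ffunE (inj_eq perm_inj).
rewrite -(card_imset _ h_inj); apply: eq_card => F; rewrite inE.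
apply/imsetP/forallP => [[F' + ->] i|e].
  rewrite inE => /forallP e; rewrite -(permKV t i) hE lt.
  by have := e (t^-1%g i); rewrite permM.
have hF : h [ffun k => t^-1%g (F k)] = F by apply/ffunP => k; rewrite !ffunE permKV.
exists [ffun k => t^-1%g (F k)]; rewrite // inE; apply/forallP => i.
by rewrite permM -lt -hE hF; apply: e.
Qed.

Definition dec l (i : 'I_N) : 'I_N -> nat := fun j => (l j - (j == i))%N.

(** Functions on [n + 1] points are sorted by their value [i] at the last point; removing that point
    lowers one fibre by one. *)
Lemma tab_count1S n l w : tab_count l w (1%g : {perm 'I_n.+1}) =
  (\sum_(i | 0 < l i) tab_count (dec l i) w (1%g : {perm 'I_n}))%N.
Proof.
rewrite tab_count1 -sum1_card (partition_big (fun F : {ffun 'I_n.+1 -> 'I_N} => F ord_max) xpredT) //=.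
rewrite [RHS]big_mkcond /=; apply: eq_bigr => i _.
pose ext (F' : {ffun 'I_n -> 'I_N}) : {ffun 'I_n.+1 -> 'I_N} :=
  [ffun k => if unlift ord_max k is Some k' then F' k' else i].
have ext_lift p' k : ext p' (lift ord_max k) = p' k by rewrite ffunE liftK.
have ext_max p' : ext p' ord_max = i by rewrite ffunE unlift_none.
have ext_inj : injective ext.
  by move=> p1 p2 e; apply/ffunP => k; rewrite -!ext_lift e.
have ext_res (F : {ffun 'I_n.+1 -> 'I_N}) : F ord_max = i -> ext [ffun k => F (lift ord_max k)] = F.
  move=> e; apply/ffunP => k; rewrite ffunE.
  by case: unliftP => [k' ->|->]; rewrite ?ffunE.
have fibE F' j : #|[set k | ext F' k == j]| = (#|[set k | F' k == j]| + (j == i))%N.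
  rewrite -[LHS]sum1dep_card -[X in (X + _)%N]sum1dep_card.
  rewrite big_mkcond big_ord_recr /= ext_max [i == j]eq_sym.
  congr (_ + _)%N.
  rewrite [RHS]big_mkcond /=.
  apply: eq_bigr => k _; rewrite (_ : widen_ord _ k = lift ord_max k) ?ext_lift //.
  by apply/val_inj; rewrite /= /bump leqNgt ltn_ord.
case: posnP => [l0|lpos].
  rewrite big_pred0 // => F; apply/negP; rewrite inE => /andP[/forallP e /eqP Fi].
  have := e i; rewrite l0 addn_eq0 cards_eq0 => /andP[/eqP/setP/(_ ord_max)].
  by rewrite !inE Fi eqxx.
rewrite tab_count1 -(card_imset _ ext_inj) sum1_card; apply: eq_card => F.
rewrite unfold_in inE; apply/andP/imsetP => [[/forallP e /eqP Fi]|[F']].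
  exists [ffun k => F (lift ord_max k)]; last by rewrite ext_res.
  rewrite inE; apply/forallP => j; have := e j; rewrite -{1}(ext_res _ Fi) fibE /dec.
  by move/eqP <-; rewrite addnAC addnK.
rewrite inE => /forallP e ->; rewrite ext_max eqxx; split=> //.
apply/forallP => j; rewrite fibE addnAC (eqP (e j)) /dec subnK //.
by case: eqP => [->|].
Qed.

Lemma frob_char1S n l : frob_char l (1%g : {perm 'I_n.+1}) =
  \sum_(i | (0 < l i)%N) frob_char (dec l i) (1%g : {perm 'I_n}).
Proof.
rewrite exchange_big /=; apply: eq_bigr => w _; rewrite -mulr_sumr; congr (_ * _).
rewrite tab_count1S -[LHS]natz natr_sum.
by apply: eq_bigr => i _; rewrite natz.
Qed.

(** The beta-numbers [f i + N - 1 - i] of the shape, which are strictly decreasing in [i]. *)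
Definition beta_set (f : nat -> nat) : 'I_N -> nat := fun i => (f i + rev_ord i)%N.

Definition rev_sign : int := (-1) ^+ odd_perm (perm (@rev_ord_inj N)).

(** Both sides satisfy the same recursion on [m]. Corners match term by term; lowering the
    beta-number of a row that is not a corner makes it equal to the next one, and [frob_char1_swap]
    kills the term. For [m = 0] only the reversal of the indices contributes. *)
Lemma num_tableaux_frob M m f : (N <= M)%N -> shape M N f m ->
  (num_tableaux M m f)%:Z = rev_sign * frob_char (beta_set f) (1%g : {perm 'I_m}).
Proof.
move=> NM; elim: m f => [|m IHm] f sh.
  have f0 i : (i < N)%N -> f i = 0%N.
    have [_ _ _ /eqP] := sh; rewrite sum_nat_eq0 => /forallP f0 iN.
    by apply/eqP; apply: (f0 (Ordinal iN)).
  rewrite [num_tableaux _ _ _](_ : _ = 1%N); last first.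
    rewrite /num_tableaux (_ : finset _ = [set: _]) ?cardsT ?card_ffun.
      by rewrite [X in (_ ^ X)%N]card_ord expn0.
    apply/setP => p; rewrite !inE; apply/and3P; split.
    - by apply/injectiveP => -[].
    - by apply/forallP => -[].
    - by apply/forallP => -[].
  have E w : tab_count (beta_set f) w (1%g : {perm 'I_0}) = (w == perm (@rev_ord_inj N)).
    rewrite tab_count1 -[RHS](_ : (#|[set: {ffun 'I_0 -> 'I_N}]| * (w == perm (@rev_ord_inj N)) = _)%N).
      have e0 (F : {ffun 'I_0 -> 'I_N}) i : #|[set k | F k == i]| = 0%N.
        by apply: eq_card0 => -[].
      case: eqP => [->|nw].
        rewrite muln1; apply: eq_card => F; rewrite !inE; apply/forallP => i.
        by rewrite e0 permE /beta_set f0.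
      rewrite muln0; apply: eq_card0 => F; rewrite inE; apply/negP => /forallP e.
      case: nw; apply/permP => i; apply/val_inj; rewrite permE.
      by have /eqP := e i; rewrite e0 /beta_set f0.
    by rewrite cardsT card_ffun [X in (_ ^ X)%N]card_ord expn0 mul1n.
  rewrite /frob_char (bigD1 (perm (@rev_ord_inj N))) //= big1 => [|w /negbTE wr].
    by rewrite E eqxx addr0 mulr1 -signr_addb addbb.
  by rewrite E wr mulr0.
rewrite (num_tableauxS NM sh) frob_char1S mulr_sumr -natz natr_sum big_mkcond [RHS]big_mkcond /=.
apply: eq_bigr => i _; have [df fM f0 sf] := sh.
case: ifP => [corner|/negbT ncorner].
  rewrite natz (IHm _ (remove_box_shape NM sh corner)) // /beta_set addn_gt0 (leq_ltn_trans _ corner) //=.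
  congr (_ * _); apply: eq_frob_char => j; rewrite /dec /remove_box -val_eqE /=.
  by case: eqP => [->|_]; rewrite ?subn0 // addnBAC // (leq_ltn_trans _ corner).
case: ifP => // bpos; have fi : f i = f i.+1.
  by apply/eqP; rewrite eqn_leq (df i i.+1) ?leqnSn // andbT leqNgt.
(* Row [i] is not the last one: its length would be [f N = 0] and its beta-number zero, against
   [bpos]. *)
have iN : (i.+1 < N)%N.
  rewrite ltn_neqAle ltn_ord andbT; apply/eqP => iN.
  by move: bpos; rewrite /beta_set fi iN f0 /= iN subnn.
have ii : (Ordinal iN == i) = false by rewrite -val_eqE /= -[X in _ == X]addn0 -addn1 eqn_add2l.
rewrite (@frob_char1_swap _ _ (tperm i (Ordinal iN))) ?mulr0 //; last first.
  by rewrite odd_tperm eq_sym ii.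
move=> j; rewrite /dec /beta_set; case: tpermP => [->|->|//] /=.
  by rewrite ii eqxx fi; lia.
by rewrite ii eqxx fi; lia.
Qed.
End FrobeniusDegree.

(** * The degree formula and the lower bound on degrees *)

Section DegreeBound.
Variable N : nat.
Implicit Types (l : 'I_N -> nat) (w : {perm 'I_N}).

(** The multinomial coefficient of the [l i - w i], with denominators cleared. The falling
    factorials vanish exactly when some [l i < w i], so no case distinction is needed in the
    statement. *)
Lemma tab_count1_fact n l w : (\sum_i l i = n + \sum_(i < N) i)%N ->
  (tab_count l w (1%g : {perm 'I_n}) * \prod_i (l i)`! = n`! * \prod_i (l i) ^_ (w i))%N.
Proof.
elim: n l => [|n IHn] l suml.
  have sumw : (\sum_(i < N) i = \sum_(i < N) w i)%N by rewrite (reindex_inj (@perm_inj _ w)).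
  rewrite add0n sumw in suml.
  have e0 (F : {ffun 'I_0 -> 'I_N}) i : #|[set k | F k == i]| = 0%N by apply: eq_card0 => -[].
  rewrite tab_count1 fact0 mul1n.
  have [/forallP e|/forallPn[i ne]] := boolP [forall i, w i == l i :> nat].
    rewrite (_ : finset _ = [set: _]); last first.
      by apply/setP => F; rewrite !inE; apply/forallP => i; rewrite e0 add0n.
    rewrite cardsT card_ffun [X in (_ ^ X)%N]card_ord expn0 mul1n.
    by apply: eq_bigr => i _; rewrite (eqP (e i)) ffactnn.
  rewrite (_ : finset _ = set0) ?cards0 ?mul0n; last first.
    apply/setP => F; rewrite !inE; apply/negbTE/forallPn; exists i.
    by rewrite e0 add0n.
  have [j ltj] : exists j, (l j < w j)%N.
    apply/existsP; apply: contraT; rewrite negb_exists => /forallP le.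
    have : (\sum_(j < N) (l j - w j))%N = 0%N.
      rewrite sumnB ?suml ?subnn // => j _; by rewrite leqNgt le.
    move/eqP; rewrite sum_nat_eq0 => /forallP /(_ i) /=; rewrite subn_eq0 => lei.
    by case/eqP: ne; apply/eqP; rewrite eqn_leq lei leqNgt le.
  by rewrite (bigD1 j) //= ffact_small.
rewrite tab_count1S big_distrl /=.
set P := (\prod_i (l i) ^_ (w i))%N.
(* Lowering [l i] by one and multiplying by [l i] turns the falling factorial of order [w i] into
   itself times [l i - w i]. *)
transitivity (\sum_(i < N) n`! * ((l i - w i) * P))%N.
  rewrite big_mkcond /=; apply: eq_bigr => i _; case: posnP => [l0|lpos].
    by rewrite l0 sub0n mul0n muln0.
  have decE j : j != i -> dec l i j = l j by rewrite /dec => /negbTE ->; rewrite subn0.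
  have deci : dec l i i = (l i).-1 by rewrite /dec eqxx subn1.
  have factE : (\prod_j (l j)`! = l i * \prod_j (dec l i j)`!)%N.
    rewrite (bigD1 i) //= [in RHS](bigD1 i) //= deci mulnA -{1}(prednK lpos) factS prednK //.
    by congr (_ * _)%N; apply: eq_bigr => j /decE ->.
  rewrite factE mulnCA IHn; last first.
    apply: succn_inj; rewrite -addSn -suml (bigD1 i) //= [in RHS](bigD1 i) //= deci.
    by rewrite -addSn prednK //; congr (_ + _)%N; apply: eq_bigr => j /decE.
  rewrite mulnCA; congr (_ * _)%N.
  rewrite /P (bigD1 i) //= [in RHS](bigD1 i) //= deci !mulnA [((l i - _) * _)%N]mulnC.
  rewrite -ffactnS -ffactnSr; congr (_ * _)%N; by apply: eq_bigr => j /decE ->.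
(* When [P] is nonzero none of the subtractions [l i - w i] is truncated, and they sum to
   [n + 1]. *)
have [P0|Ppos] := posnP P; first by rewrite P0 muln0 big1 // => i _; rewrite !muln0.
rewrite -big_distrr /= -big_distrl /= factS mulnCA -!mulnA; congr (_ * _)%N.
rewrite sumnB; last first.
  move=> i _; rewrite leqNgt; apply: contraL Ppos => ltl.
  by rewrite -leqNgt leqn0 /P (bigD1 i) //= ffact_small.
by rewrite suml (reindex_inj (@perm_inj _ w)) /= addnK.
Qed.

(** The falling factorial of order [j] is a monic polynomial of degree [j], so the matrix is a
    Vandermonde matrix times a unitriangular one. *)
Lemma det_ffact (R : comNzRingType) l :
  \det (\matrix_(i < N, j < N) ((l i) ^_ j)%:R : 'M[R]_N) =
  \prod_(i < N) \prod_(j < N | (i < j)%N) ((l j)%:R - (l i)%:R).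
Proof.
pose p (j : nat) : {poly R} := \prod_(t < j) ('X - t%:R%:P).
have pE j m : (p j).[m%:R] = (m ^_ j)%:R.
  rewrite /p horner_prod.
  elim: j => [|j IHj]; first by rewrite big_ord0 ffactn0.
  rewrite big_ord_recr /= IHj hornerXsubC ffactnSr natrM.
  case: (ltnP m j) => mj; first by rewrite ffact_small // !mul0r.
  by rewrite natrB.
have szp j : size (p j) = j.+1.
  by rewrite /p size_prod_XsubC [size _](_ : _ = j) // /index_enum -enumT size_enum_ord.
have mp j : p j \is monic by apply: monic_prod_XsubC.
pose V := Vandermonde N (\row_i (l i)%:R : 'rV[R]_N).
pose C : 'M[R]_N := \matrix_(j, k) (p j)`_k.
have -> : \matrix_(i < N, j < N) ((l i) ^_ j)%:R = (C *m V)^T :> 'M[R]_N.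
  apply/matrixP => i j; rewrite !mxE -pE (@horner_coef_wide _ N); last by rewrite szp.
  by apply: eq_bigr => k _; rewrite !mxE.
have detC : \det C = 1.
  rewrite det_trig; last by apply/is_trig_mxP => i j ij; rewrite mxE nth_default // szp.
  by rewrite big1 // => j _; rewrite mxE; have /monicP := mp j; rewrite lead_coefE szp.
rewrite det_tr det_mulmx det_Vandermonde detC mul1r.
by apply: eq_bigr => i _; apply: eq_bigr => j _; rewrite !mxE.
Qed.

(** Frobenius's degree formula: by [tab_count1_fact] the alternating sum is a determinant of falling
    factorials. *)
Lemma frob_char1_fact n l : (\sum_i l i = n + \sum_(i < N) i)%N ->
  frob_char l (1%g : {perm 'I_n}) * (\prod_i (l i)`!)%:Z =
  (n`!)%:Z * \prod_(i < N) \prod_(j < N | (i < j)%N) ((l j)%:Z - (l i)%:Z).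
Proof.
move=> suml.
have -> : \prod_(i < N) \prod_(j < N | (i < j)%N) ((l j)%:Z - (l i)%:Z) =
    \det (\matrix_(i < N, j < N) ((l i) ^_ j)%:R : 'M[int]_N).
  by rewrite det_ffact; under eq_bigr => i _ do under eq_bigr => j _ do rewrite -!natz.
rewrite mulr_suml mulr_sumr; apply: eq_bigr => w _.
rewrite -mulrA [RHS]mulrCA; congr (_ * _); rewrite -PoszM tab_count1_fact // PoszM.
congr (_ * _); rewrite -natz natr_prod; apply: eq_bigr => i _.
by rewrite mxE.
Qed.

End DegreeBound.

(** The factors of [m!] outside [s] are [m - size s] numbers, each at most [m <= L]. *)
Lemma fact_le_prod (L m : nat) (s : seq nat) : uniq s ->
  {subset s <= iota 1 m} -> (m <= L)%N -> (m`! <= L ^ (m - size s) * \prod_(v <- s) v)%N.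
Proof.
move=> us sub mL.
have -> : (m`! = \prod_(v <- iota 1 m) v)%N.
  by rewrite fact_prod /index_iota subSS subn0.
rewrite (bigID (fun v => v \in s)) /= mulnC leq_mul //; last first.
  rewrite -big_filter leq_eqVlt; apply/orP; left; apply/eqP; apply: perm_big.
  apply: uniq_perm; rewrite ?filter_uniq ?iota_uniq // => v.
  by rewrite mem_filter; apply/andP/idP => [[]|sv] //; rewrite sv sub.
rewrite -big_filter.
have -> : (m - size s = size [seq v <- iota 1 m | v \notin s])%N.
  rewrite size_filter -[in LHS](size_iota 1 m) -(count_predC (mem s) (iota 1 m)).
  rewrite -size_filter [size [seq _ <- _ | _]](_ : _ = size s) ?addKn //.
  apply: perm_size; apply: uniq_perm; rewrite ?filter_uniq ?iota_uniq // => v.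
  by rewrite mem_filter; apply/andP/idP => [[]|sv] //; split; rewrite ?sub.
have : all (fun v => v <= L)%N [seq v <- iota 1 m | v \notin s].
  apply/allP => v; rewrite mem_filter mem_iota add1n ltnS => /and3P[_ _ vm].
  exact: leq_trans mL.
elim: [seq v <- iota 1 m | v \notin s] => [|v r IHr]; first by rewrite big_nil.
by case/andP=> vL /IHr le; rewrite big_cons expnS leq_mul.
Qed.

(* The differences l_i - l_j (j > i) are distinct elements of [1, l_i]; the
   other elements of [1, l_i] (the hook lengths of row i) are at most L. *)
Lemma prod_fact_beta_le (N L : nat) (f : nat -> nat) :
  {homo f : i j / (i <= j)%N >-> (j <= i)%N} -> (f 0%N + N <= L)%N ->
  (\prod_(i < N) (beta_set f i)`! <= L ^ (\sum_(i < N) f i) *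
     \prod_(i < N) \prod_(j < N | i < j) (beta_set f i - beta_set f j))%N.
Proof.
move=> df fL; rewrite expn_sum -big_split /=; apply: leq_prod => i _.
have lt (j k : 'I_N) : (j < k)%N -> (beta_set f k < beta_set f j)%N.
  by move=> jk; have := df _ _ (ltnW jk); have := ltn_ord k; rewrite /beta_set /=; lia.
pose s := [seq (beta_set f i - beta_set f j)%N | j : 'I_N <- enum 'I_N & (i < j)%N].
have szs : size s = (N - i.+1)%N.
  rewrite size_map size_filter -(count_map (@nat_of_ord N) (fun j => (i < j)%N)) val_enum_ord.
  have eN : iota 0 N = iota 0 (i.+1 + (N - i.+1)) by rewrite subnKC.
  rewrite eN iotaD count_cat add0n.
  rewrite (eq_in_count (a2 := pred0)) ?count_pred0 => [|j]; last first.
    by rewrite mem_iota add0n ltnS => /andP[_]; rewrite leqNgt => /negbTE.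
  rewrite add0n (eq_in_count (a2 := predT)) ?count_predT ?size_iota // => j.
  by rewrite mem_iota => /andP[].
rewrite -[X in (L ^ X)%N](addnK (N - i.+1)) -{2}szs.
have -> : (\prod_(j < N | i < j) (beta_set f i - beta_set f j) = \prod_(v <- s) v)%N.
  by rewrite big_map big_filter big_enum_cond.
apply: fact_le_prod.
- rewrite map_inj_in_uniq ?(filter_uniq _ (enum_uniq _)) // => j k.
  rewrite !mem_filter => /andP[ij _] /andP[ik _].
  have := lt _ _ ij; have := lt _ _ ik => lk lj e.
  apply/val_inj; case: (ltngtP j k) => // /lt; lia.
- move=> v /mapP[j]; rewrite mem_filter mem_iota => /andP[ij _] ->.
  by have := lt _ _ ij; lia.
by apply: leq_trans _ fL; rewrite leq_add ?df ?leq_subr.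
Qed.

(** * The characters attached to partitions *)

Section IrreducibleCharacter.
Variables (n : nat) (nu : seq nat).
Hypothesis part_nu : is_partition n nu.
Local Notation N := (size nu).
Local Notation f := (nth 0%N nu).
Local Notation l := (beta_set f : 'I_N -> nat).

Lemma sum_nth_sumn (s : seq nat) : (\sum_(i < size s) nth 0 s i = sumn s)%N.
Proof. by rewrite sumnE (big_nth 0%N) big_mkord. Qed.

Lemma size_le_sumn (s : seq nat) : all (fun x => 0 < x)%N s -> (size s <= sumn s)%N.
Proof. by elim: s => //= x s IHs /andP[x0 /IHs]; lia. Qed.

Lemma nth_le_sumn (s : seq nat) i : (nth 0 s i <= sumn s)%N.
Proof.
elim: s i => [|x s IHs] [|i] //=; first exact: leq_addr.
by rewrite (leq_trans (IHs i)) ?leq_addl.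
Qed.

Lemma partition_shape : shape n N f n.
Proof.
have /and3P[srt _ /eqP sm] := part_nu; split.
- move=> i j ij; case: (ltnP j N) => [jN|Nj]; last by rewrite nth_default.
  apply: (sorted_leq_nth (leT := geq)) => //.
  + by move=> a b c /= ab bc; apply: leq_trans bc ab.
  + by move=> a /=.
  by rewrite inE (leq_ltn_trans ij).
- by move=> i; rewrite -[in X in (_ <= X)%N]sm nth_le_sumn.
- by rewrite nth_default.
by rewrite sum_nth_sumn.
Qed.

Lemma size_partition_le : (N <= n)%N.
Proof. by have /and3P[_ pos /eqP <-] := part_nu; apply: size_le_sumn. Qed.

Lemma nSYT_num_tableaux : nSYT n nu = num_tableaux n n f.
Proof.
apply: eq_card => p; rewrite !inE; congr [&& _, _ & _].
apply: eq_forallb => k; rewrite /in_diagram /in_shape /=.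
by case: ltnP => // leN; rewrite [nth 0%N nu _]nth_default.
Qed.

(** Composing [w] with the reversal of the indices turns [nu_i - i + w i] into a beta-number minus
    [w i], at the cost of one global sign. *)
Lemma irr_char_frob (x : {perm 'I_n}) : irr_char nu x = rev_sign N * frob_char l x.
Proof.
pose s : {perm 'I_N} := perm (@rev_ord_inj N).
rewrite /irr_char (reindex_inj (mulIg s)) mulr_sumr; apply: eq_bigr => w _.
rewrite odd_permM signr_addb [_ * (-1) ^+ odd_perm s]mulrC -mulrA; congr (_ * (_ * _%:Z)).
apply: eq_card => F; rewrite !inE; congr (_ && _); apply: eq_forallb => i.
rewrite permM permE /beta_set /= -[RHS]eqz_nat PoszD.
have := ltn_ord i; have := ltn_ord (w i) => /=; rewrite (_ : nu`_i = f i) //.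
by set c := #|_|; lia.
Qed.

Lemma beta_set_inj : injective l.
Proof.
have [df _ _ _] := partition_shape.
suff lt (j k : 'I_N) : (j < k)%N -> (l k < l j)%N.
  move=> j k e; apply/val_inj; case: (ltngtP j k) => // /lt; rewrite e ltnn //.
by move=> jk; have := df _ _ (ltnW jk); have := ltn_ord k; rewrite /beta_set /=; lia.
Qed.

Lemma sum_beta_set : (\sum_i l i = n + \sum_(i < N) i)%N.
Proof.
have [_ _ _ <-] := partition_shape; rewrite big_split /=; congr (_ + _)%N.
by rewrite [RHS](reindex_inj (@rev_ord_inj N)).
Qed.

Lemma irr_char1 : irr_char nu (1%g : {perm 'I_n}) = (nSYT n nu)%:Z.
Proof.
by rewrite irr_char_frob nSYT_num_tableaux (num_tableaux_frob size_partition_le partition_shape).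
Qed.

Lemma rev_sign_sqr : rev_sign N * rev_sign N = 1.
Proof. by rewrite -signr_addb addbb. Qed.

Lemma irr_charJ (x y : {perm 'I_n}) : irr_char nu (x ^ y)%g = irr_char nu x.
Proof.
rewrite !irr_char_frob; congr (_ * _); apply: (@intr_inj algC).
by rewrite -!frob_cfunE cfunJ ?inE.
Qed.

Lemma irr_char_average (x z : {perm 'I_n}) :
  (n`!)%:Z * (irr_char nu x * irr_char nu z) =
  (nSYT n nu)%:Z * \sum_y irr_char nu (x * z ^ y)%g.
Proof.
rewrite -irr_char1 !irr_char_frob mulrACA rev_sign_sqr mul1r.
under eq_bigr => y _ do rewrite irr_char_frob.
rewrite -mulr_sumr mulrACA rev_sign_sqr mul1r.
exact: frob_char_average beta_set_inj sum_beta_set x z.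
Qed.

Lemma irr_char_norm_le (x : {perm 'I_n}) : `|irr_char nu x| <= (nSYT n nu)%:Z.
Proof.
rewrite -[leRHS]ger0_norm // -irr_char1 !irr_char_frob !normrM normr_sign !mul1r.
exact: frob_char_le1 beta_set_inj sum_beta_set x.
Qed.

Lemma irr_char_sqr_le (x : {perm 'I_n}) : irr_char nu x ^+ 2 <= #|'C[x]%g|%:Z.
Proof.
rewrite irr_char_frob exprMn sqrr_sign mul1r.
exact: frob_char_sqr_le beta_set_inj sum_beta_set x.
Qed.

(** In the hook length formula every hook is at most [nu_1 + nu'_1]; the degree formula with
    [prod_fact_beta_le] gives this without naming the hooks. *)
Lemma fact_le_nSYT : (n`! <= nSYT n nu * (part_row1 nu + part_col1 nu) ^ n)%N.
Proof.
have sh := partition_shape; have [df _ _ sf] := sh.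
have := prod_fact_beta_le df (leqnn (f 0 + N)%N); rewrite sf.
set P := (\prod_i _)%N; set D := (\prod_i \prod_(j | _) _)%N => PD.
have fP : (nSYT n nu * P = n`! * D)%N.
  apply/eqP; rewrite -eqz_nat !PoszM; apply/eqP.
  rewrite -[(nSYT n nu)%:Z]ger0_norm // -irr_char1 irr_char_frob normrM normr_sign mul1r.
  rewrite -[P%:Z]ger0_norm // -normrM /P frob_char1_fact ?sum_beta_set // normrM ger0_norm //.
  congr (_ * _); rewrite normr_prod -[RHS]natz natr_prod; apply: eq_bigr => i _.
  rewrite normr_prod natr_prod; apply: eq_bigr => j ij.
  have lt : (l j < l i)%N.
    by have := df _ _ (ltnW ij); have := ltn_ord j; rewrite /beta_set /=; lia.
  by rewrite natz; lia.
have P0 : (0 < P)%N by apply: prodn_gt0 => i; apply: fact_gt0.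
have D0 : (0 < D)%N.
  by case: (posnP D) => // eD; move: PD P0; rewrite eD muln0 leqn0 => /eqP ->.
rewrite -(leq_pmul2r D0) -fP -mulnA leq_mul2l orbC.
by rewrite /part_row1 -nth0 /part_col1 PD.
Qed.

End IrreducibleCharacter.

(** * Exponential decay of character ratios *)

Section Support.
Variable n : nat.
Implicit Types (x y z : {perm 'I_n}).

Definition moved x : {set 'I_n} := [set k | x k != k].

Lemma moved1 : moved 1%g = set0.
Proof. by apply/setP => k; rewrite !inE perm1 eqxx. Qed.

Lemma moved_eq0 x : (moved x == set0) = (x == 1%g).
Proof.
apply/eqP/eqP => [e|->]; last exact: moved1.
apply/permP => k; rewrite perm1; have := in_set0 k; rewrite -e inE.
by move/negbFE/eqP.
Qed.

Lemma movedJ x y : moved (x ^ y)%g = [set y k | k in moved x].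
Proof.
apply/setP => k; apply/idP/imsetP => [|[j + ->]]; last first.
  by rewrite !inE permJ (inj_eq perm_inj).
rewrite inE => kx; exists (y^-1%g k); rewrite ?permKV // inE.
by apply: contra kx => /eqP e; rewrite -[k](permKV y) permJ e.
Qed.

Lemma card_movedJ x y : #|moved (x ^ y)%g| = #|moved x|.
Proof. by rewrite movedJ card_imset //; apply: perm_inj. Qed.

(** The product moves each point moved by [z] and fixed by [x], and each point moved by [x] whose
    image is fixed by [z]. The map [x] carries the latter onto the points moved by [x] and fixed by
    [z]. *)
Lemma card_moved_mul_ge x z :
  (#|moved x| + #|moved z| <= #|moved (x * z)%g| + 2 * #|moved x :&: moved z|)%N.
Proof.
have sub : moved z :\: moved x :|: [set k in moved x | x k \notin moved z] \subset moved (x * z)%g.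
  apply/subsetP => k; rewrite !inE permM => /orP[/andP[/negbNE/eqP xk]|/andP[xk /negbNE/eqP ->]].
    by rewrite xk.
  by [].
have dis : [disjoint moved z :\: moved x & [set k in moved x | x k \notin moved z]].
  by rewrite -setI_eq0; apply/eqP/setP => k; rewrite !inE; case: (x k =P k) => _ /=; rewrite ?andbF.
have := subset_leq_card sub; rewrite cardsU disjoint_setI0 // cards0 subn0.
have := cardsID (moved x) (moved z); rewrite setIC.
have xinj : #|[set k in moved x | x k \notin moved z]| = #|moved x :\: moved z|.
  rewrite -[LHS](card_imset _ (@perm_inj _ x)); apply: eq_card => k; rewrite !inE.
  apply/imsetP/andP => [[j + ->]|[zk xk]].
    by rewrite !inE (inj_eq perm_inj) => /andP[-> ->].
  exists (x^-1%g k); rewrite ?permKV // !inE permKV zk andbT.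
  by rewrite -(inj_eq (@perm_inj _ x)) permKV.
by rewrite xinj; have := cardsID (moved z) (moved x); lia.
Qed.

Lemma card_moved_mul_le x z : (#|moved (x * z)%g| <= #|moved x| + #|moved z|)%N.
Proof.
apply: leq_trans (subset_leq_card _) (leq_card_setU _ _).1.
apply/subsetP => k; rewrite !inE permM; case: (x k =P k) => //= ->.
by [].
Qed.

(** An element of the centralizer is determined by its values at one representative of each cycle,
    and [m] is the number of cycles. Nontrivial cycles have at least two points. *)
Lemma card_cent1_le x : exists2 m, (#|'C[x]%g| <= n ^ m)%N & (2 * m + #|moved x| <= 2 * n)%N.
Proof.
pose rep k : 'I_n := odflt k [pick j in porbit x k].
have rep_orbit k : rep k \in porbit x k.
  rewrite /rep; case: pickP => [j //|_].
  exact: porbit_id.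
have rep_eq j k : j \in porbit x k -> rep j = rep k.
  rewrite porbit_sym -eq_porbit_mem => /eqP e; rewrite /rep e.
  case: pickP => [//|none].
  by have /negP[] := negbT (none j); apply: porbit_id.
pose S := [set rep k | k in 'I_n].
have repS j : j \in S -> rep j = j.
  by case/imsetP=> k _ ->; apply: rep_eq.
exists #|S|.
  pose h y : {ffun 'I_#|S| -> 'I_n} := [ffun i => y (enum_val i)].
  have cardF : #|{ffun 'I_#|S| -> 'I_n}| = (n ^ #|S|)%N by rewrite card_ffun !card_ord.
  rewrite -cardF -(@card_in_imset _ _ h) ?max_card // => y y' /cent1P cy /cent1P cy' /ffunP e.
  apply/permP => k.
  have Sk : rep k \in S by apply/imsetP; exists k.
  have := rep_orbit k; rewrite porbit_sym => /porbitP[i ->].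
  have comm u : commute x u -> u ((x ^+ i)%g (rep k)) = (x ^+ i)%g (u (rep k)).
    by move=> cu; rewrite -!permM (commuteX2 i 1) ?expg1 //.
  rewrite (comm y) // (comm y') //; congr ((x ^+ i)%g _).
  by have := e (enum_rank_in Sk (rep k)); rewrite !ffunE enum_rankK_in.
(* The image under [x] of a moved representative is another moved point of the same cycle, hence not
   a representative. *)
have le1 : (2 * #|S :&: moved x| <= #|moved x|)%N.
  rewrite mul2n -addnn -{2}(card_imset (mem (S :&: moved x)) (@perm_inj _ x)).
  have dis : [disjoint S :&: moved x & [set x k | k in S :&: moved x]].
    rewrite -setI_eq0; apply/eqP/setP => k; rewrite in_set0; apply/negP.
    rewrite in_setI => /andP[/setIP[/repS Sk _] /imsetP[j /setIP[/repS Sj]]].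
    rewrite inE => xj ek; case/eqP: xj; rewrite -ek -Sk -[RHS]Sj; apply: rep_eq.
    by rewrite ek; have := mem_porbit x 1 j; rewrite expg1.
  rewrite -[X in (X <= _)%N]subn0 -(cards0 'I_n) -(disjoint_setI0 dis) -cardsU.
  apply: subset_leq_card; rewrite subUset subsetIr /=.
  by apply/subsetP => _ /imsetP[k /setIP[_ mk] ->]; move: mk; rewrite !inE (inj_eq perm_inj).
have := cardsID (moved x) S.
have : (#|S :\: moved x| + #|moved x| <= n)%N.
  rewrite -[X in (X <= _)%N]subn0 -(cards0 'I_n).
  rewrite -(disjoint_setI0 (_ : [disjoint S :\: moved x & moved x])) -?cardsU.
    by rewrite -[X in (_ <= X)%N](card_ord n) max_card.
  by rewrite -setI_eq0 setIDAC setDIl setDv setI0.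
move: le1; set b1 := #|_ :&: _|; set b2 := #|_ :\: _|; set b3 := #|moved x|; set b4 := #|S|.
lia.
Qed.

End Support.

(** * Overlap of a random image with a fixed set *)

Section RandomIntersection.
Variables (n : nat) (B : {set 'I_n}).
Implicit Types (D A : {set 'I_n}) (y : {perm 'I_n}).

Definition sends D : {set {perm 'I_n}} := [set y : {perm 'I_n} | [forall k in D, y k \in B]].

Lemma card_sendsU1 D q q' : q \notin D -> q' \notin D ->
  #|sends (q |: D)| = #|sends (q' |: D)|.
Proof.
have le p p' : p \notin D -> p' \notin D -> (#|sends (p |: D)| <= #|sends (p' |: D)|)%N.
  move=> pD p'D; rewrite -(card_imset _ (mulgI (tperm p p'))); apply: subset_leq_card.
  apply/subsetP => _ /imsetP[y + ->]; rewrite !inE => /forall_inP yB.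
  apply/forall_inP => k; rewrite !inE permM => /orP[/eqP ->|kD].
    by rewrite tpermR yB // !inE eqxx.
  rewrite tpermD ?yB // ?inE ?kD ?orbT //; first by apply: contraNneq pD => ->.
  by apply: contraNneq p'D => ->.
by move=> qD q'D; apply/eqP; rewrite eqn_leq !le.
Qed.

(** Double counting of the pairs of [p] outside [D] and [y] in [sends D] with [y p] in [B]: all [p]
    give the same count by [card_sendsU1], and each [y] has [#|B| - #|D|] such points. *)
Lemma card_sends_step D q : q \notin D ->
  ((n - #|D|) * #|sends (q |: D)| = (#|B| - #|D|) * #|sends D|)%N.
Proof.
move=> qD.
have -> : (n - #|D|)%N = #|~: D| by have := cardsC D; rewrite card_ord; lia.
transitivity (\sum_(p in ~: D) \sum_(y in sends D) (y p \in B))%N.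
  rewrite -sum_nat_const; apply: eq_bigr => p; rewrite inE => pD.
  rewrite (card_sendsU1 qD pD) -sum1_card big_mkcond [RHS]big_mkcond /=.
  apply: eq_bigr => y _; rewrite !inE.
  have -> : [forall k in p |: D, y k \in B] = (y p \in B) && [forall k in D, y k \in B].
    apply/forall_inP/andP => [yB|[yp /forall_inP yB] k].
      by rewrite yB ?setU11 //; split=> //; apply/forall_inP => k kD; rewrite yB // inE kD orbT.
    by rewrite !inE => /orP[/eqP ->//|/yB].
  by case: (y p \in B); case: [forall k in D, _].
rewrite exchange_big /= mulnC -sum_nat_const; apply: eq_bigr => y.
rewrite inE => /forall_inP yB.
have -> : (\sum_(p in ~: D) (y p \in B) = #|[set p in ~: D | y p \in B]|)%N.
  rewrite -sum1_card big_mkcond [RHS]big_mkcond /=; apply: eq_bigr => p _.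
  by rewrite !inE; case: (p \in D) => //=; case: (_ \in B).
rewrite -(card_imset _ (@perm_inj _ y)) -(card_imset (mem D) (@perm_inj _ y)).
rewrite -[in RHS](cardsID [set y k | k in D] B) (_ : B :&: _ = [set y k | k in D]) ?addKn.
  apply: eq_card => k; rewrite inE; apply/imsetP/andP => [[p + ->]|[kD kB]].
    by rewrite !inE (mem_imset _ _ (@perm_inj _ y)) => /andP[].
  exists (y^-1%g k); rewrite ?permKV // !inE permKV kB andbT.
  by apply: contra kD => kD; apply/imsetP; exists (y^-1%g k); rewrite ?permKV.
by apply/setIidPr/subsetP => _ /imsetP[k /yB ykB ->].
Qed.

(** A random permutation maps [D] into [B] with probability at most [(#|B| / n)^#|D|], since
    [(b - d) / (n - d) <= b / n] at each step. *)
Lemma card_sends_le D : (n ^ #|D| * #|sends D| <= n`! * #|B| ^ #|D|)%N.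
Proof.
move: {2}#|D| (leqnn #|D|) => m; elim: m D => [|m IHm] D.
  rewrite leqn0 cards_eq0 => /eqP ->; rewrite cards0 !expn0 mul1n muln1.
  by rewrite -card_Sn max_card.
case: (set_0Vmem D) => [->|[q qD]]; first by move=> _; apply: IHm; rewrite cards0.
rewrite -(setD1K qD); set D' := D :\ q => leD.
have qD' : q \notin D' by rewrite !inE eqxx.
have Dm : (#|D'| <= m)%N by move: leD; rewrite cardsU1 qD'.
have Dn : (#|D'| < n)%N.
  by rewrite -[X in (_ < X)%N]card_ord -[X in (X <= _)%N](_ : #|q |: D'| = _) ?max_card // cardsU1 qD'.
have Bn : (#|B| <= n)%N by rewrite -[X in (_ <= X)%N]card_ord max_card.
have step : (n * #|sends (q |: D')| <= #|B| * #|sends D'|)%N.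
  rewrite -(leq_pmul2l (_ : 0 < n - #|D'|)%N) ?subn_gt0 // mulnCA card_sends_step //.
  rewrite !mulnA leq_mul2r; apply/orP; right.
  by rewrite mulnBr mulnBl leq_sub2l // mulnC leq_mul2r Bn orbT.
rewrite cardsU1 qD' !add1n !expnSr -mulnA (leq_trans (leq_mul (leqnn _) step)) //.
by rewrite mulnCA mulnA [X in (_ <= X)%N]mulnA [X in (_ <= X)%N]mulnC -mulnA leq_mul2l IHm ?orbT.
Qed.

(** An exponential moment of the overlap: expand [(1 + c)] to the overlap as a sum over subsets [D]
    of [A] sent into [B], bound each term by [card_sends_le], and resum by the binomial theorem. *)
Lemma sum_exp_card_sends A c :
  (n ^ #|A| * \sum_(y : {perm 'I_n}) c.+1 ^ #|[set k in A | y k \in B]| <= n`! * (n + c * #|B|) ^ #|A|)%N.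
Proof.
have expE (S : {set 'I_n}) a b :
    ((a + b) ^ #|S| = \sum_(D : {set 'I_n} | D \subset S) a ^ (#|S| - #|D|) * b ^ #|D|)%N.
  transitivity (\prod_k ((if k \in S then b else 0) + (if k \in S then a else 1)))%N.
    rewrite -prod_nat_const big_mkcond /=; apply: eq_bigr => k _.
    by case: (k \in S) => //; rewrite addnC.
  rewrite bigA_distr [RHS]big_mkcond /=; apply: eq_bigr => D _.
  case: ifPn => [DS|/subsetPn[k kD kS]]; last by rewrite (bigD1 k) //= kD (negbTE kS).
  rewrite (_ : #|S| - #|D| = #|S :\: D|)%N ; last by rewrite cardsD (setIidPr DS).
  rewrite -!prod_nat_const [X in (X * _)%N]big_mkcond [X in (_ * X)%N]big_mkcond -big_split /=.
  apply: eq_bigr => k _; rewrite !inE; case: ifP => [/(subsetP DS) ->|_]; first by rewrite mul1n.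
  by case: (k \in S); rewrite muln1.
have -> : (\sum_(y : {perm 'I_n}) c.+1 ^ #|[set k in A | y k \in B]| =
    \sum_(D : {set 'I_n} | D \subset A) c ^ #|D| * #|sends D|)%N.
  under eq_bigr => y _ do rewrite -add1n expE big_mkcond.
  rewrite exchange_big [RHS]big_mkcond /=; apply: eq_bigr => D _.
  case: ifPn => [DA|nDA].
    rewrite mulnC -sum_nat_const [RHS]big_mkcond /=; apply: eq_bigr => y _.
    rewrite exp1n mul1n inE; congr (if _ then _ else _).
    apply/subsetP/forall_inP => sub k kD; have := sub k kD; rewrite !inE.
      by case/andP.
    by move=> ->; rewrite (subsetP DA).
  apply: big1 => y _; case: ifP => // /subsetP sub; case/negP: nDA.
  by apply/subsetP => k /sub; rewrite inE => /andP[].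
rewrite expE big_distrr [X in (_ <= X)%N]big_distrr /=; apply: leq_sum => D DA.
rewrite -{1}(subnK (subset_leq_card DA)) expnD expnMn -!mulnA.
rewrite [X in (_ <= X)%N]mulnCA leq_mul2l; apply/orP; right.
by rewrite mulnCA [X in (_ <= X)%N]mulnCA leq_mul2l card_sends_le orbT.
Qed.
End RandomIntersection.

(** * Decay of ratios through products of random conjugates *)

Section Decay.
Variables (R : realType) (n : nat) (r : {perm 'I_n} -> R).
Implicit Types x y z : {perm 'I_n}.

(** With [s], [k] the supports and [o] their overlap, the product moves at least [s + k - 2 o]
    points, and the mean of [4^o] is at most [(1 + 3 k / n)^s <= exp(3 k / 32)] as [s <= n / 32]. *)
Lemma sum_half_moved x z : (32 * #|moved x| <= n)%N ->
  \sum_y 2^-1 ^+ #|moved (x * z ^ y)%g| <=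
  (n`!)%:R * (2^-1 ^+ #|moved x| * expR (- (#|moved z|%:R / 4))) :> R.
Proof.
move=> xn; set s := #|moved x|; set k := #|moved z|.
have [n0|npos] := posnP n.
  have sm0 (u : {perm 'I_n}) : #|moved u| = 0%N.
    by apply: eq_card0 => j; have := ltn_ord j; rewrite {2}n0.
  rewrite /s /k !sm0 mul0r oppr0 expR0 !mulr1 -card_Sn -sum1_card natr_sum.
  by apply: ler_sum => y _; rewrite sm0 expr0.
pose o y := #|[set j in moved x | y j \in moved z]|.
have le1 y : 2^-1 ^+ #|moved (x * z ^ y^-1)%g| <= 2^-1 ^+ (s + k) * 4 ^+ o y :> R.
  have oE : o y = #|moved x :&: moved (z ^ y^-1)%g|.
    apply: eq_card => j; rewrite inE in_setI movedJ; congr (_ && _).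
    apply/idP/imsetP => [yj|[i zi ->]]; last by rewrite permKV.
    by exists (y j); rewrite ?permK.
  have := card_moved_mul_ge x (z ^ y^-1)%g; rewrite card_movedJ -/s -/k -oE => le.
  have -> : (4 : R) = 2 ^+ 2 by rewrite -natrX.
  rewrite -exprM; apply: (@le_trans _ _ (2^-1 ^+ (#|moved (x * z ^ y^-1)%g| + 2 * o y) * 2 ^+ (2 * o y))).
    by rewrite exprD -mulrA -exprMn mulVf // expr1n mulr1.
  rewrite ler_wpM2r ?exprn_ge0 // ler_wiXn2l // ?invr_ge0 // invf_le1 //.
  by rewrite ler1n.
rewrite (reindex_inj invg_inj) /=; apply: (le_trans (ler_sum _ (fun y _ => le1 y))).
rewrite -mulr_sumr.
have le2 : \sum_y 4 ^+ o y <= (n`!)%:R * expR (3 * k%:R / 32) :> R.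
  have := sum_exp_card_sends (moved z) (moved x) 3; rewrite -(ler_nat R) natrM natr_sum natrM !natrX natrD.
  under eq_bigr => y _ do rewrite natrX -/(o y).
  rewrite -/s -/k mulrC -ler_pdivlMr ?exprn_gt0 ?ltr0n // => /le_trans; apply.
  rewrite -[leLHS]mulrA -expr_div_n ler_wpM2l // mulrDl divff ?pnatr_eq0 -?lt0n //.
  apply: (@le_trans _ _ (expR ((3 * k)%:R / n%:R) ^+ s)).
    by rewrite lerXn2r ?nnegrE ?expR_ge0 ?addr_ge0 ?divr_ge0 ?expR_ge1Dx.
  rewrite -expRM_natl ler_expR natrM mulrCA ler_wpM2l ?mulr_ge0 //.
  rewrite ler_pdivrMr ?ltr0n // mulrC ler_pdivlMr //.
  by rewrite -natrM ler_nat mulnC.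
apply: (le_trans (ler_wpM2l _ le2)); first by rewrite exprn_ge0 ?invr_ge0.
rewrite mulrCA ler_wpM2l // exprD -[leLHS]mulrA ler_wpM2l ?exprn_ge0 ?invr_ge0 //.
have -> : 3 * k%:R / 32 = k%:R * (3 / 32) :> R by field.
have -> : - (k%:R / 4) = k%:R * (- 4^-1) :> R by field.
rewrite !expRM_natl -exprMn lerXn2r ?nnegrE ?mulr_ge0 ?expR_ge0 ?invr_ge0 //.
rewrite -expRM_natl.
(* What remains is [exp(11/32) <= 2], which follows from [exp(-t) >= 1 - t] at [t = 11/32]. *)
have -> : 3 / 32 = - 4^-1 + 11 / 32 :> R by field.
rewrite expRD mulrCA ger_pMr ?expR_gt0 //.
have := expR_ge1Dx (- (11 / 32) : R); rewrite expRN => h.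
rewrite -ler_pdivlMr ?expR_gt0 // mul1r (le_trans _ h) //.
lra.
Qed.

Hypothesis r_average : forall x z, (n`!)%:R * (r x * r z) = \sum_y r (x * z ^ y)%g.
Variable delta : R.
Hypothesis r_base : forall x, `|r x| <= expR (delta * n%:R) * 2^-1 ^+ #|moved x|.

(** Each factor [r z] is absorbed by averaging over [x * z ^ y], and [sum_half_moved] gains
    [exp(- supp(z) / 4)] each time. The condition keeps the support of the left factor within
    [n / 32] at every multiplication; the final product is unrestricted, whence [j.-1]. *)
Lemma ratio_iter z j x :
  ((0 < j) ==> (32 * (#|moved x| + j.-1 * #|moved z|) <= n))%N ->
  `|r x| * `|r z| ^+ j <=
  expR (delta * n%:R) * (2^-1 ^+ #|moved x| * expR (- (#|moved z|%:R / 4)) ^+ j).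
Proof.
elim: j x => [|j IHj] x /=; first by move=> _; rewrite !expr0 !mulr1.
move=> cond; have n0 : 0 < (n`!)%:R :> R by rewrite ltr0n fact_gt0.
set E := expR (- _).
rewrite -(ler_pM2l n0) exprS mulrA -normrM mulrA.
have -> : (n`!)%:R * `|r x * r z| = `|\sum_y r (x * z ^ y)%g|.
  by rewrite -r_average [RHS]normrM (ger0_norm (ltW n0)).
apply: (le_trans (ler_wpM2r _ (ler_norm_sum _ _ _))); first exact: exprn_ge0.
rewrite mulr_suml.
have step y : `|r (x * z ^ y)%g| * `|r z| ^+ j <=
    (expR (delta * n%:R) * E ^+ j) * 2^-1 ^+ #|moved (x * z ^ y)%g|.
  rewrite -mulrA [E ^+ j * _]mulrC; apply: IHj; apply/implyP => j0.
  apply: leq_trans cond; rewrite leq_mul2l /= -{2}(prednK j0) mulSn addnA leq_add2r.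
  by rewrite -(card_movedJ z y) card_moved_mul_le.
apply: (le_trans (ler_sum _ (fun y _ => step y))); rewrite -mulr_sumr.
have xn : (32 * #|moved x| <= n)%N by apply: leq_trans cond; rewrite leq_mul2l leq_addr.
apply: (le_trans (ler_wpM2l _ (sum_half_moved z xn))).
  by rewrite mulr_ge0 ?exprn_ge0 ?expR_ge0.
by rewrite -/E exprS le_eqVlt; apply/orP; left; apply/eqP; ring.
Qed.

Lemma ratio_decay z : r 1%g = 1 -> delta <= 256^-1 ->
  `|r z| <= expR (- (#|moved z|%:R / 8)).
Proof.
move=> r1 led; set k := #|moved z|.
have [k0|kpos] := posnP k.
  have /eqP : moved z == set0 by rewrite -cards_eq0 -/k k0.
  move/eqP; rewrite moved_eq0 => /eqP ->.
  by rewrite r1 normr1 k0 mul0r oppr0 expR0.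
(* The largest [j] that [ratio_iter] allows. Then [n <= 32 k j], so [delta n <= n / 256 <= k j / 8]
   uses up half of the gain [k j / 4]. *)
pose j := (n %/ (32 * k)).+1.
have := @ratio_iter z j 1%g; rewrite moved1 cards0 add0n /= r1 normr1 mul1r expr0 mul1r.
rewrite mulnCA [X in (X <= n)%N](_ : _ = n %/ (32 * k) * (32 * k))%N ?leq_trunc_div; last by [].
move=> /(_ isT) le.
have nj : (n <= 32 * k * j)%N by rewrite ltnW // mulnC ltn_ceil // muln_gt0.
suff : `|r z| ^+ j <= expR (- (k%:R / 8)) ^+ j by rewrite ler_pXn2r ?nnegrE ?expR_ge0.
apply: (le_trans le); rewrite -!expRM_natl -expRD ler_expR.
have : n%:R <= 32 * k%:R * j%:R :> R by rewrite -!natrM ler_nat.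
have : 0 <= n%:R :> R by [].
have : delta * n%:R <= 256^-1 * n%:R by rewrite ler_wpM2r.
by rewrite -/k; nra.
Qed.

End Decay.

(** Fourth powers avoid the half-integral exponent [n - supp(x) / 2] of the bound on the square. *)
Lemma irr_char_pow4_le n nu (x : {perm 'I_n}) : (0 < n)%N -> is_partition n nu ->
  irr_char nu x ^+ 4 * (n ^ #|moved x|)%:Z <= (n ^ (2 * n))%:Z.
Proof.
move=> n0 part; have [m le1 le2] := card_cent1_le x.
have le3 : irr_char nu x ^+ 2 <= (n ^ m)%:Z by rewrite (le_trans (irr_char_sqr_le part x)) // lez_nat.
have le4 : irr_char nu x ^+ 4 <= (n ^ (2 * m))%:Z.
  rewrite (exprM _ 2 2) mulnC expnM PoszM -expr2 lerXn2r ?nnegrE ?sqr_ge0 //.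
apply: (@le_trans _ _ ((n ^ (2 * m))%:Z * (n ^ #|moved x|)%:Z)); first by rewrite ler_wpM2r.
by rewrite -PoszM -expnD lez_nat leq_pexp2l.
Qed.

Lemma expn_le_fact_expR (R : realType) n : (n%:R : R) ^+ n <= (n`!)%:R * expR n%:R.
Proof.
case: n => [|n]; first by rewrite expr0 fact0 mul1r expR0.
have := expR_ge1Dxn n (ler0n R n.+1); rewrite -ler_pdivrMl ?ltr0n ?fact_gt0 //.
by apply: le_trans; rewrite mulrC lerDr.
Qed.

(** If [m supp(x) <= n], the factor [exp(n / m)] outweighs [2^(- supp(x))] and the trivial bound 1
    suffices. Otherwise exponential factors in [n] are exponential in the support, and the power
    [n^supp(x)] from [irr_char_pow4_le] beats them. *)
Lemma irr_char_ratio_base (R : realType) (a : R) (m : nat) : 0 < a -> (0 < m)%N ->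
  exists N : nat, forall n : nat, (N <= n)%N -> forall nu, is_partition n nu ->
    (part_row1 nu)%:R <= a * Num.sqrt n%:R -> (part_col1 nu)%:R <= a * Num.sqrt n%:R ->
    (0 < nSYT n nu)%N /\ forall x : {perm 'I_n},
      `|(irr_char nu x)%:~R / (nSYT n nu)%:R| <= expR (m%:R^-1 * n%:R) * 2^-1 ^+ #|moved x| :> R.
Proof.
move=> a0 m0; pose c : R := Num.max 1 (4 * a ^+ 2 * expR 1 ^+ 2).
have c1 : 1 <= c by rewrite le_max lexx.
have c0 : 0 < c by apply: lt_le_trans c1.
pose N := (Num.trunc (16 * c ^+ (2 * m))).+1.
exists N => n Nn nu part rowle colle.
have nN : 16 * c ^+ (2 * m) <= n%:R.
  by apply: ltW; apply: lt_le_trans (truncnS_gt _) _; rewrite ler_nat.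
have npos : (0 < n)%N by apply: leq_trans Nn.
have nR : 0 < n%:R :> R by rewrite ltr0n.
set f : R := (nSYT n nu)%:R.
have f0 : 0 <= f by [].
pose L : R := (part_row1 nu + part_col1 nu)%:R.
have L2 : L ^+ 2 <= 4 * a ^+ 2 * n%:R.
  have -> : 4 * a ^+ 2 * n%:R = (2 * (a * Num.sqrt n%:R)) ^+ 2 :> R.
    by rewrite !exprMn sqr_sqrtr // -natrX mulrA.
  rewrite lerXn2r ?nnegrE ?mulr_ge0 ?sqrtr_ge0 ?(ltW a0) //.
  by rewrite /L natrD mulr_natl mulr2n lerD.
have fge : n%:R ^+ (2 * n) <= f ^+ 4 * c ^+ (2 * n).
  have h1 : n%:R ^+ n <= f * L ^+ n * expR n%:R :> R.
    apply: (le_trans (expn_le_fact_expR R n)); rewrite ler_wpM2r ?expR_ge0 //.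
    by rewrite -natrX -natrM ler_nat fact_le_nSYT.
  have h2 : n%:R ^+ (4 * n) <= f ^+ 4 * c ^+ (2 * n) * n%:R ^+ (2 * n).
    have XE : (f * L ^+ n * expR n%:R) ^+ 4 = f ^+ 4 * (L ^+ 2 * expR 1 ^+ 2) ^+ (2 * n).
      have -> : expR n%:R = expR 1 ^+ n :> R by rewrite -expRM_natl mulr1.
      rewrite !exprMn -!exprM -mulrA.
      by rewrite -!exprD -mulnDl mulnC.
    rewrite mulnC exprM -[leRHS]mulrA -exprMn.
    apply: (@le_trans _ _ ((f * L ^+ n * expR n%:R) ^+ 4)).
      have X0 : 0 <= f * L ^+ n * expR n%:R.
        by apply: mulr_ge0; rewrite ?expR_ge0 // mulr_ge0 ?exprn_ge0.
      by rewrite lerXn2r ?nnegrE ?exprn_ge0.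
    rewrite XE ler_wpM2l ?exprn_ge0 // lerXn2r ?nnegrE ?mulr_ge0 ?sqr_ge0 ?(ltW c0) //.
    apply: (@le_trans _ _ (4 * a ^+ 2 * n%:R * expR 1 ^+ 2)).
      by rewrite ler_wpM2r ?sqr_ge0.
    by rewrite mulrAC ler_wpM2r // le_max lexx orbT.
  move: h2; rewrite (_ : 4 * n = 2 * n + 2 * n)%N; last by rewrite -mulnDl.
  by rewrite exprD ler_pM2r ?exprn_gt0.
(* Existence of a tableau comes from the lower bound [fge] itself. *)
have fpos : 0 < f.
  rewrite lt0r f0 andbT; apply/eqP => f00.
  by move: fge; rewrite f00 expr0n /= mul0r leNgt exprn_gt0.
split; first by move: fpos; rewrite ltr0n.
move=> x; set k := #|moved x|; set r := _ / _.
have r1 : `|r| <= 1.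
  rewrite /r normrM normfV [`|f|]ger0_norm // ler_pdivrMr // mul1r.
  by rewrite -intr_norm /f pmulrn ler_int irr_char_norm_le.
have e2 : 2 <= expR 1 :> R by have := expR_ge1Dx (1 : R); lra.
have [kn|nk] := leqP (m * k) n.
  apply: (le_trans r1); rewrite exprVn -ler_pdivrMr ?invr_gt0 ?exprn_gt0 // invrK mul1r.
  apply: (@le_trans _ _ (expR 1 ^+ k)); first by rewrite lerXn2r ?nnegrE ?expR_ge0.
  rewrite -expRM_natl mulr1 ler_expR mulrC ler_pdivlMr ?ltr0n // mulrC.
  by rewrite -natrM ler_nat.
have r4 : `|r| ^+ 4 * n%:R ^+ k <= c ^+ (2 * n).
  have := irr_char_pow4_le x npos part; rewrite -(ler_int R) rmorphM rmorphXn /= -!pmulrn !natrX -/k.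
  move=> /le_trans /(_ fge) h.
  have rE : `|r| ^+ 4 = (irr_char nu x)%:~R ^+ 4 / f ^+ 4.
    by rewrite (exprM _ 2 2) real_normK ?num_real // -exprM /r -expr_div_n.
  by rewrite rE mulrAC ler_pdivrMr ?exprn_gt0 // [leRHS]mulrC.
apply: (@le_trans _ _ (2^-1 ^+ k)); last first.
  by rewrite ler_peMl ?exprn_ge0 ?invr_ge0 // -expR0 ler_expR mulr_ge0 ?invr_ge0.
(* Here [n < m k]. Together with [n >= 16 c^(2 m)] this leaves [|r|^4 16^k <= 1], that is
   [|r| <= 2^(-k)]. *)
have ck : c ^+ (2 * n) <= (c ^+ (2 * m)) ^+ k.
  by rewrite -exprM ler_weXn2l // -mulnA leq_mul2l ltnW.
have r16 : `|r| ^+ 4 * 16 ^+ k <= 1.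
  have cc : 0 < (c ^+ (2 * m)) ^+ k by rewrite !exprn_gt0.
  rewrite -(ler_pM2r cc) mul1r -mulrA -exprMn (le_trans _ ck) // (le_trans _ r4) //.
  by rewrite ler_wpM2l ?exprn_ge0 // lerXn2r ?nnegrE ?mulr_ge0 ?exprn_ge0 ?(ltW c0).
rewrite exprVn -[leRHS]mul1r ler_pdivlMr ?exprn_gt0 //.
rewrite -(@ler_pXn2r _ 4) ?nnegrE ?mulr_ge0 ?exprn_ge0 // expr1n exprMn.
by rewrite -exprM mulnC exprM (_ : 2 ^+ 4 = 16 :> R) // -natrX.
Qed.

Lemma irr_char_ratio_decay (R : realType) (a : R) : 0 < a ->
  exists N : nat, forall n : nat, (N <= n)%N -> forall nu, is_partition n nu ->
    (part_row1 nu)%:R <= a * Num.sqrt n%:R -> (part_col1 nu)%:R <= a * Num.sqrt n%:R ->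
    (0 < nSYT n nu)%N /\ forall z : {perm 'I_n},
      `|(irr_char nu z)%:~R / (nSYT n nu)%:R| <= expR (- (#|moved z|%:R / 8)) :> R.
Proof.
(* The bound [delta <= 1/256] is what [ratio_decay] asks for. *)
move=> a0; pose m := 256%N.
have [N base] := irr_char_ratio_base a0 (isT : 0 < m)%N.
exists N => n Nn nu part rowle colle; have [fpos bound] := base n Nn nu part rowle colle.
have f0 : (nSYT n nu)%:R != 0 :> R by rewrite pnatr_eq0 -lt0n.
split=> // z; pose r (x : {perm 'I_n}) : R := (irr_char nu x)%:~R / (nSYT n nu)%:R.
apply: (@ratio_decay R n r _ m%:R^-1) => //.
- move=> x y; rewrite /r -mulr_suml mulrACA [LHS]mulrA.
  have := congr1 (fun u : int => u%:~R : R) (irr_char_average part x y).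
  rewrite !rmorphM /= [X in _ = _ * X -> _]rmorph_sum /= -!pmulrn => ->.
  by rewrite mulrACA divff // mul1r.
by rewrite /r (irr_char1 part) -pmulrn divff.
Qed.

(** * Restriction to the centralizer *)

Section Centralizer.
Variables (n : nat) (sigma : {perm 'I_n}).
Local Notation P := (porbits sigma).
Local Notation Z := (centralizer_set sigma).
Hypothesis distinct_sizes :
  {in P &, forall O1 O2 : {set 'I_n}, #|O1| = #|O2| -> O1 = O2}.

Lemma centralizer_comm z i k : z \in Z -> z ((sigma ^+ i)%g k) = (sigma ^+ i)%g (z k).
Proof.
rewrite inE => /eqP cz; have c : commute z (sigma ^+ i)%g by apply: commuteX.
by rewrite -!permM c.
Qed.

Lemma porbits_porbit O k : O \in P -> k \in O -> O = porbit sigma k.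
Proof. by case/imsetP=> j _ ->; rewrite -eq_porbit_mem => /eqP ->. Qed.

(** An element commuting with [sigma] permutes the cycles and preserves their sizes; distinct sizes
    force it to stabilize each cycle. *)
Lemma centralizer_porbit z k : z \in Z -> z k \in porbit sigma k.
Proof.
move=> Zz; rewrite -eq_porbit_mem; apply/eqP; apply: distinct_sizes; rewrite ?imset_f //.
rewrite -(card_imset (mem (porbit sigma k)) (@perm_inj _ z)); apply: eq_card => j.
apply/porbitP/imsetP => [[i ->]|[k' /porbitP[i ->] ->]].
  by exists ((sigma ^+ i)%g k); rewrite ?mem_porbit // (centralizer_comm i k Zz).
by exists i; rewrite (centralizer_comm i k Zz).
Qed.

Lemma porbit_expg_eq i j r q : q \in porbit sigma r ->
  (sigma ^+ i)%g r = (sigma ^+ j)%g r -> (sigma ^+ i)%g q = (sigma ^+ j)%g q.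
Proof.
have c a b k : (sigma ^+ a)%g ((sigma ^+ b)%g k) = (sigma ^+ b)%g ((sigma ^+ a)%g k).
  by rewrite -!permM -!expgD addnC.
by case/porbitP=> t -> e; rewrite c e c.
Qed.

Variable p0 : 'I_n.

Definition cycle_rep (O : {set 'I_n}) : 'I_n := odflt p0 [pick p in O].

Lemma cycle_rep_mem O : O \in P -> cycle_rep O \in O.
Proof.
case/imsetP=> k _ ->; rewrite /cycle_rep; case: pickP => [//|none].
by have /negP[] := negbT (none k); apply: porbit_id.
Qed.

Lemma cycle_rep_porbit k : cycle_rep (porbit sigma k) \in porbit sigma k.
Proof. by rewrite cycle_rep_mem ?imset_f. Qed.

(** Coordinates on the centralizer, one per cycle; the value [p0] elsewhere is the default required
    by [pfamily]. *)
Definition cycle_images (z : {perm 'I_n}) : {ffun {set 'I_n} -> 'I_n} :=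
  [ffun O => if O \in P then z (cycle_rep O) else p0].

Lemma cycle_images_inj : {in Z &, injective cycle_images}.
Proof.
move=> z z' Zz Zz' /ffunP e; apply/permP => k.
have := e (porbit sigma k); rewrite !ffunE imset_f // => er.
have := cycle_rep_porbit k; rewrite porbit_sym => /porbitP[i ->].
by rewrite !centralizer_comm // er.
Qed.

Lemma cycle_images_mem z : z \in Z ->
  cycle_images z \in pfamily p0 (mem P) (fun O : {set 'I_n} => mem O).
Proof.
move=> Zz; apply/pfamilyP; split=> [|O PO].
  by apply/supportP => O /negbTE PO; rewrite ffunE PO.
rewrite ffunE PO; have rO := cycle_rep_mem PO.
by rewrite {2}(porbits_porbit PO rO) centralizer_porbit.
Qed.

(** The preimage sends [sigma^i r] to [sigma^i (phi O)] for the representative [r] of [O]; by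
    [porbit_expg_eq] this does not depend on the choice of [i]. *)
Lemma cycle_images_onto phi : phi \in pfamily p0 (mem P) (fun O : {set 'I_n} => mem O) ->
  exists2 z, z \in Z & cycle_images z = phi.
Proof.
case/pfamilyP=> /supportP phi0 phiO.
have /fin_all_exists[ex exE] : forall k, exists i : nat,
    k = (sigma ^+ i)%g (cycle_rep (porbit sigma k)).
  by move=> k; have := cycle_rep_porbit k; rewrite porbit_sym => /porbitP.
pose q k := phi (porbit sigma k).
have qO k : q k \in porbit sigma (cycle_rep (porbit sigma k)).
  have := phiO (porbit sigma k) (imset_f _ _); rewrite -/(q k) => /(_ isT).
  by have := cycle_rep_porbit k; rewrite -eq_porbit_mem => /eqP ->.
pose f k := (sigma ^+ ex k)%g (q k).
have q_eq k j : porbit sigma j = porbit sigma k -> q j = q k by rewrite /q => ->.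
have fE k i : k = (sigma ^+ i)%g (cycle_rep (porbit sigma k)) -> f k = (sigma ^+ i)%g (q k).
  by move=> e; apply: (porbit_expg_eq (qO k)); rewrite -exE.
have fO k : porbit sigma (f k) = porbit sigma k.
  rewrite porbit_perm; apply/eqP.
  have := qO k; rewrite -eq_porbit_mem => /eqP ->.
  by rewrite eq_porbit_mem cycle_rep_porbit.
have f_inj : injective f.
  move=> k k' e; have eO : porbit sigma k = porbit sigma k' by rewrite -fO e fO.
  rewrite [k]exE [k']exE -eO; apply: (@porbit_expg_eq _ _ (q k)).
    by rewrite porbit_sym qO.
  by move: e; rewrite /f (q_eq k k') // -(q_eq k k').
exists (perm f_inj).
  rewrite inE; apply/eqP/permP => k; rewrite !permM !permE.
  have eO : porbit sigma (sigma k) = porbit sigma k by have := porbit_perm sigma 1 k; rewrite expg1.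
  rewrite (fE (sigma k) (ex k).+1) ?(q_eq k) //; last by rewrite eO expgSr permM -exE.
  by rewrite expgSr permM.
apply/ffunP => O; rewrite ffunE; case: ifP => [PO|/negbT nPO]; last by rewrite phi0.
have rO := cycle_rep_mem PO; have eO := porbits_porbit PO rO.
by rewrite permE (fE _ 0%N) ?expg0 ?perm1 /q -eO.
Qed.

(** Through [cycle_images] the centralizer is the product of the cycles as a set, and the identity
    becomes distributivity. *)
Lemma sum_centralizer (R : comNzRingType) (F : {set 'I_n} -> 'I_n -> R) :
  \sum_(z in Z) \prod_(O in P) F O (z (cycle_rep O)) =
  \prod_(O in P) \sum_(q in O) F O q.
Proof.
rewrite (big_distr_big_dep p0) /=.
transitivity (\sum_(z in Z) \prod_(O in P) F O (cycle_images z O)).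
  by apply: eq_bigr => z _; apply: eq_bigr => O PO; rewrite ffunE PO.
rewrite -(big_imset (fun phi : {ffun {set 'I_n} -> 'I_n} => \prod_(O in P) F O (phi O)) cycle_images_inj) /=.
apply: eq_bigl => phi; apply/imsetP/idP => [[z Zz ->]|/cycle_images_onto[z Zz <-]].
  exact: cycle_images_mem.
by exists z.
Qed.

Lemma card_centralizer : #|Z| = z_distinct sigma.
Proof.
apply/eqP; rewrite -eqz_nat -!natz /z_distinct natr_prod -sum1_card natr_sum; apply/eqP.
transitivity (\sum_(z in Z) \prod_(O in P) (1 : int)).
  by apply: eq_bigr => z _; rewrite big1.
rewrite (sum_centralizer (fun _ _ => 1)); apply: eq_bigr => O _.
by rewrite -sum1_card natr_sum.
Qed.

Lemma centralizer_fix z k : z \in Z -> (z k == k) = (z (cycle_rep (porbit sigma k)) == cycle_rep (porbit sigma k)).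
Proof.
move=> Zz; have := cycle_rep_porbit k; rewrite porbit_sym => /porbitP[i {1 2}->].
by rewrite centralizer_comm // (inj_eq perm_inj).
Qed.

Lemma card_moved_centralizer z : z \in Z ->
  #|moved z| = (\sum_(O in P) if z (cycle_rep O) == cycle_rep O then 0 else #|O|)%N.
Proof.
move=> Zz; rewrite -sum1_card big_mkcond /=.
rewrite (partition_big (porbit sigma) (mem P)) /=; last by move=> k _; rewrite imset_f.
apply: eq_bigr => O PO.
have memO k : (porbit sigma k == O) = (k \in O).
  have := cycle_rep_mem PO => rO; rewrite (porbits_porbit PO rO) eq_porbit_mem.
  by [].
case: ifP => fixO.
  rewrite big1 // => k; rewrite memO inE => kO.
  by rewrite (centralizer_fix _ Zz) -(porbits_porbit PO kO) fixO.
rewrite -[RHS]sum1_card; apply: eq_big => k; first by rewrite memO.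
rewrite memO inE => kO.
by rewrite (centralizer_fix _ Zz) -(porbits_porbit PO kO) fixO.
Qed.

End Centralizer.

(** Frobenius reciprocity: after conjugating [x], each of the [n!] terms [y] of the induced
    character contributes the same sum over the centralizer. *)
Lemma lie_schur_coeffE (R : rcfType) n (sigma : {perm 'I_n}) (omega : nat -> R[i]) nu :
  is_partition n nu ->
  lie_schur_coeff sigma omega nu = #|centralizer_set sigma|%:R^-1 *
    \sum_(z in centralizer_set sigma) lie_lin_char sigma omega z * (irr_char nu z)%:~R.
Proof.
move=> part; rewrite /lie_schur_coeff /higher_lie_char.
under eq_bigr => x _ do rewrite -mulrA mulr_suml.
rewrite -mulr_sumr mulrCA exchange_big /=; congr (_ * _).
set Sz := \sum_(z in _) _.
have E (y : {perm 'I_n}) : \sum_x (if (x ^ y)%g \in centralizer_set sigma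
    then lie_lin_char sigma omega (x ^ y)%g else 0) * (irr_char nu x)%:~R = Sz.
  rewrite (reindex_inj (conjg_inj y^-1%g)) /Sz [RHS]big_mkcond /=.
  apply: eq_bigr => x _; rewrite conjgKV irr_charJ //.
  by case: ifP => // _; rewrite mul0r.
under eq_bigr => y _ do rewrite E.
have n0 : (n`!)%:R != 0 :> R[i] by rewrite pnatr_eq0 -lt0n fact_gt0.
have -> : \sum_(y : {perm 'I_n}) Sz = Sz *+ n`! by rewrite sumr_const card_Sn.
by rewrite -[Sz *+ _]mulr_natl mulKf.
Qed.

Lemma norm_primitive_root (C : numDomainType) m (w : C) :
  (0 < m)%N -> m.-primitive_root w -> `|w| = 1.
Proof.
move=> m0 /prim_expr_order e; apply/eqP; rewrite -(@pexpr_eq1 _ _ m) //.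
by rewrite -normrX e normr1.
Qed.

Lemma norm_lie_lin_char (R : rcfType) n (sigma z : {perm 'I_n}) (omega : nat -> R[i]) :
  (forall m, (0 < m)%N -> m.-primitive_root (omega m)) ->
  `|lie_lin_char sigma omega z| = 1.
Proof.
move=> prim; rewrite normr_prod big1 // => O _; case: pickP => [p Op|_]; last exact: normr1.
have O0 : (0 < #|O|)%N by apply/card_gt0P; exists p.
by rewrite normrX (norm_primitive_root O0 (prim _ O0)) expr1n.
Qed.

Lemma lie_lin_char1 (R : rcfType) n (sigma : {perm 'I_n}) (omega : nat -> R[i]) :
  lie_lin_char sigma omega 1%g = 1.
Proof.
rewrite /lie_lin_char big1 // => O _; case: pickP => // p _.
by rewrite perm1 findex0 expr0.
Qed.

(** * Bound on the remainder by a product over cycles *)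

Section RemainderBound.
Variables (R : realType) (n : nat) (sigma : {perm 'I_n}) (omega : nat -> R[i]) (nu : seq nat).
Local Notation P := (porbits sigma).
Local Notation Z := (centralizer_set sigma).
Hypothesis distinct_sizes :
  {in P &, forall O1 O2 : {set 'I_n}, #|O1| = #|O2| -> O1 = O2}.
Hypothesis prim_omega : forall m, (0 < m)%N -> m.-primitive_root (omega m).
Hypothesis part : is_partition n nu.
Hypothesis nSYT_pos : (0 < nSYT n nu)%N.
Variable p0 : 'I_n.

(** The factor [z_mu] cancels the order of the centralizer, and the identity element accounts for
    the subtracted 1. *)
Lemma remainderE : remainder sigma omega nu =
  \sum_(z in Z | z != 1%g)
    lie_lin_char sigma omega z * ((irr_char nu z)%:~R / (nSYT n nu)%:R).
Proof.
have f0 : (nSYT n nu)%:R != 0 :> R[i] by rewrite pnatr_eq0 -lt0n.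
have Z1 : 1%g \in Z by rewrite inE mul1g mulg1.
have z0 : #|Z|%:R != 0 :> R[i] by rewrite pnatr_eq0 -lt0n; apply/card_gt0P; exists 1%g.
rewrite /remainder lie_schur_coeffE // -(card_centralizer distinct_sizes p0) mulVKf //.
rewrite (bigD1 1%g Z1) /= lie_lin_char1 mul1r irr_char1 // -pmulrn mulrDl divff //.
rewrite addrAC subrr add0r mulr_suml; apply: eq_bigr => z _.
by rewrite mulrA.
Qed.

Hypothesis decay : forall z : {perm 'I_n},
  `|(irr_char nu z)%:~R / (nSYT n nu)%:R| <= expR (- (#|moved z|%:R / 8)) :> R.

Lemma norm_remainder_le : `|remainder sigma omega nu| <=
  real_complex R (\prod_(O in P) (1 + (#|O|.-1)%:R * expR (- (#|O|%:R / 8))) - 1).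
Proof.
pose B (O : {set 'I_n}) : R := expR (- (#|O|%:R / 8)).
(* A cycle is fixed pointwise if its representative is fixed; otherwise all its [#|O|] points move.
   Hence the weight factors over cycles. *)
pose F (O : {set 'I_n}) (q : 'I_n) : R := if q == cycle_rep p0 O then 1 else B O.
have sumF : \sum_(z in Z) expR (- (#|moved z|%:R / 8)) =
    \prod_(O in P) (1 + (#|O|.-1)%:R * B O).
  transitivity (\sum_(z in Z) \prod_(O in P) F O (z (cycle_rep p0 O))).
    apply: eq_bigr => z Zz; rewrite (card_moved_centralizer p0 Zz).
    rewrite natr_sum mulr_suml -sumrN expR_sum; apply: eq_bigr => O _.
    by rewrite /F; case: ifP => // _; rewrite mul0r oppr0 expR0.
  rewrite (sum_centralizer distinct_sizes p0 F); apply: eq_bigr => O PO.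
  have rO := cycle_rep_mem p0 PO; rewrite (bigD1 _ rO) /= {1}/F eqxx; congr (1 + _).
  rewrite (cardsD1 (cycle_rep p0 O) O) rO /= mulr_natl -sumr_const.
  apply: eq_big => q; first by rewrite !inE andbC.
  by rewrite /F => /andP[_ /negbTE ->].
rewrite remainderE; apply: (le_trans (ler_norm_sum _ _ _)).
have Z1 : 1%g \in Z by rewrite inE mul1g mulg1.
move: sumF; rewrite (bigD1 1%g Z1) /= moved1 cards0 mul0r oppr0 expR0 => <-.
rewrite addrAC subrr add0r rmorph_sum /=; apply: ler_sum => z _.
rewrite normrM norm_lie_lin_char // mul1r.
have -> : (irr_char nu z)%:~R / (nSYT n nu)%:R =
    real_complex R ((irr_char nu z)%:~R / (nSYT n nu)%:R).
  by rewrite rmorphM fmorphV rmorph_int rmorph_nat.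
rewrite normc_def /= expr0n addr0 sqrtr_sqr lecR.
exact: decay.
Qed.

End RemainderBound.

(** * Asymptotics *)

Section Asymptotics.
Variable R : realType.
Implicit Types (c e q x : R).

Lemma expR_sub1_le x : expR x - 1 <= x * expR x.
Proof.
have h : (1 - x) * expR x <= 1.
  rewrite -[leRHS](expRxMexpNx_1 x) [leRHS]mulrC ler_wpM2r ?expR_ge0 //.
  exact: expR_ge1Dx.
by move: h; rewrite mulrBl mul1r; lra.
Qed.

(** A single term of the exponential series, of degree [trunc q + 3], suffices: [trunc q + 1] powers
    of [x] cover [x^q], one covers the factor [x], and the last one, at least [M], absorbs the
    constants. *)
Lemma expR_beats_powR c q e : 0 <= c -> 0 < q -> 0 < e ->
  exists2 M, 1 <= M & forall x, M <= x -> c * x * expR (- (x / 16)) <= e * x `^ (- q).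
Proof.
move=> c0 q0 e0; pose m := Num.trunc q; pose n := m.+2.
pose M := Num.max 1 (c * 16 ^+ n.+1 * (n.+1)`!%:R / e).
exists M => [|x]; first by rewrite le_max lexx.
rewrite ge_max => /andP[x1 xM]; have x0 : 0 < x by apply: lt_le_trans x1.
have fpos : 0 < (n.+1)`!%:R :> R by rewrite ltr0n fact_gt0.
have xq : x `^ q <= x ^+ m.+1.
  rewrite -powR_mulrn ?(ltW x0) // ler_powR //.
  by apply: ltW; apply: truncnS_gt.
have ex : x ^+ n.+1 <= 16 ^+ n.+1 * (n.+1)`!%:R * expR (x / 16).
  have := expR_ge1Dxn n (divr_ge0 (ltW x0) (ler0n R 16)).
  rewrite expr_div_n => h; have {h} : x ^+ n.+1 / 16 ^+ n.+1 / (n.+1)`!%:R <= expR (x / 16).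
    by apply: le_trans h; rewrite lerDr.
  by rewrite ler_pdivrMr // ler_pdivrMr ?exprn_gt0 // mulrC [expR _ * _]mulrC mulrA.
rewrite powRN expRN -ler_pdivlMr ?invr_gt0 ?expR_gt0 // invrK.
rewrite mulrAC ler_pdivlMr ?powR_gt0 //.
apply: (@le_trans _ _ (c * x * x ^+ m.+1)); first by rewrite ler_wpM2l ?mulr_ge0 // ltW.
rewrite -mulrA -exprS -(ler_pM2l x0).
have -> : x * (c * x ^+ m.+2) = c * x ^+ n.+1 by rewrite mulrCA -exprS.
apply: (le_trans (ler_wpM2l c0 ex)); rewrite [leLHS]mulrA [leRHS]mulrA ler_wpM2r ?expR_ge0 // [leLHS]mulrA.
by move: xM; rewrite ler_pdivrMr.
Qed.

(** Half of the exponent cancels the size, by [y exp(- y / 16) <= 16]; the other half is at most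
    [exp(- x / 16)]. Then [1 + u <= exp u]. *)
Lemma prod_decay_le (I : finType) (P : {set I}) (size_of : I -> nat) x :
  (forall i, i \in P -> x <= (size_of i)%:R) ->
  \prod_(i in P) (1 + (size_of i).-1%:R * expR (- ((size_of i)%:R / 8))) <=
  expR (#|P|%:R * (16 * expR (- (x / 16)))).
Proof.
move=> le; rewrite expRM_natl -prodr_const; apply: ler_prod => i Pi.
rewrite addr_ge0 ?mulr_ge0 ?expR_ge0 //=; apply: le_trans (expR_ge1Dx _).
rewrite lerD2l; set y := (size_of i)%:R : R.
have y16 : y * expR (- (y / 16)) <= 16.
  rewrite expRN ler_pdivrMr ?expR_gt0 //.
  by have := expR_ge1Dx (y / 16); lra.
have -> : expR (- (y / 8)) = expR (- (y / 16)) * expR (- (y / 16)).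
  by rewrite -expRD; congr expR; field.
rewrite mulrA; apply: ler_pM; rewrite ?mulr_ge0 ?expR_ge0 //.
  by apply: le_trans y16; rewrite ler_wpM2r ?expR_ge0 // ler_nat leq_pred.
by rewrite ler_expR lerN2 ler_wpM2r ?le.
Qed.

End Asymptotics.

Theorem theorem5p1 (R : realType) (f g : nat -> R)
  (* f(n) -> oo *)
  (hf : forall M : R, exists N : nat, forall n : nat, (N <= n)%N -> M <= f n)
  (* g(n) = O(f(n) / ln n) *)
  (hgO : exists (K : R) (N : nat), forall n : nat, (N <= n)%N ->
           `|g n| <= K * (f n / ln n%:R))
  (* g(n) = o(sqrt n) *)
  (hgo : forall eps : R, 0 < eps -> exists N : nat, forall n : nat, (N <= n)%N ->
           `|g n| <= eps * Num.sqrt n%:R)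
  (* for each n, sigma n is a permutation whose cycle type mu = (m_1 > ... > m_t)
     (the sizes of its cycles) is the partition of the statement *)
  (sigma : forall n : nat, {perm 'I_n})
  (* omega n m : value of the chosen primitive character zeta_m of Z_m on the
     generating m-cycle, i.e. a primitive m-th root of unity *)
  (omega : nat -> nat -> R[i])
  (homega : forall n m : nat, (0 < m)%N -> m.-primitive_root (omega n m))
  (hmu : exists N : nat, forall n : nat, (N <= n)%N ->
     [/\ (* distinct parts *)
         {in porbits (sigma n) &, forall O1 O2 : {set 'I_n}, #|O1| = #|O2| -> O1 = O2},
         (* t <= g(n) *)
         (#|porbits (sigma n)|%:R <= g n) &
         (* m_t >= f(n) *)
         (forall O, O \in porbits (sigma n) -> f n <= #|O|%:R)])
  (a : R) (ha : 0 < a) :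
  forall q : R, 0 < q ->
  forall eps : R, 0 < eps -> exists N : nat, forall n : nat, (N <= n)%N ->
    forall nu : seq nat, is_partition n nu ->
      (part_row1 nu)%:R <= a * Num.sqrt n%:R ->
      (part_col1 nu)%:R <= a * Num.sqrt n%:R ->
      `|remainder (sigma n) (omega n) nu| <= real_complex R (eps * f n `^ (- q)).
Proof.
move=> q q0 eps eps0.
have [K [N1 gK]] := hgO; have [N2 mu] := hmu.
have [N3 decay] := irr_char_ratio_decay ha.
have e1 : 0 < expR 1 :> R := expR_gt0 1.
(* The remainder will be at most [exp s - 1 <= s exp s]. The minimum with 1 ensures [s <= 1], and
   the division by [exp 1] then compensates [exp s]. *)
have e'0 : 0 < Num.min 1 eps / expR 1 by rewrite divr_gt0 // lt_min ltr01 eps0.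
have c0 : 0 <= 16 * `|K| by rewrite mulr_ge0.
have [M M1 beats] := expR_beats_powR c0 q0 e'0.
have [N4 fM] := hf M.
(* For [n >= e] one has [ln n >= 1], so the number of cycles is at most [|K| f n]. *)
pose N5 := (Num.trunc (expR 1 : R)).+1.
exists (maxn N1 (maxn N2 (maxn N3 (maxn N4 N5)))) => n.
rewrite !geq_max => /and5P[n1 n2 n3 n4 n5] nu part rowle colle.
have [dist tg fO] := mu n n2.
have {decay}[fpos decay] := decay n n3 nu part rowle colle.
have fn := fM n n4; have {beats} beats := beats _ fn.
have npos : (0 < n)%N := leq_trans (ltn0Sn _) n5.
have en : expR 1 <= n%:R :> R.
  by apply: ltW; apply: lt_le_trans (truncnS_gt _) _; rewrite ler_nat.
have ln1 : 1 <= ln n%:R :> R.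
  by rewrite -[leLHS](expRK 1) ler_ln ?posrE ?expR_gt0 ?ltr0n.
have f1 : 1 <= f n := le_trans M1 fn.
have f0 : 0 < f n := lt_le_trans ltr01 f1.
have tK : #|porbits (sigma n)|%:R <= `|K| * f n.
  apply: (le_trans tg); apply: (le_trans (ler_norm _)); apply: (le_trans (gK n n1)).
  have fl : 0 <= f n / ln n%:R by rewrite divr_ge0 ?ltW // (lt_le_trans ltr01 ln1).
  apply: (@le_trans _ _ (`|K| * (f n / ln n%:R))); first by rewrite ler_wpM2r ?ler_norm.
  by rewrite ler_wpM2l // ler_pdivrMr ?(lt_le_trans ltr01 ln1) // ler_peMr // ltW.
apply: (le_trans (norm_remainder_le dist (homega n) part fpos (Ordinal npos) decay)).
rewrite lecR.
set s : R := 16 * `|K| * f n * expR (- (f n / 16)) in beats *.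
have s0 : 0 <= s by rewrite !mulr_ge0 ?expR_ge0 // ltW.
have prods : \prod_(O in porbits (sigma n)) (1 + #|O|.-1%:R * expR (- (#|O|%:R / 8))) <= expR s.
  apply: (le_trans (prod_decay_le (size_of := fun O : {set 'I_n} => #|O|) fO)).
  rewrite ler_expR [leLHS]mulrCA /s -!(mulrA 16) ler_wpM2l //.
  by rewrite ler_wpM2r ?expR_ge0.
apply: (le_trans (lerB prods (lexx 1))); apply: (le_trans (expR_sub1_le s)).
have p0 : 0 <= f n `^ (- q) := powR_ge0 _ _.
have s1 : s <= 1.
  apply: (le_trans beats); rewrite powRN -[leRHS]mulr1 ler_pM ?invr_ge0 ?powR_ge0 ?(ltW e'0) //.
    rewrite ler_pdivrMr // mul1r (@le_trans _ _ 1) ?ge_min ?lexx // -expR0 ler_expR //.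
  by rewrite invf_le1 ?powR_gt0 // -(powRr0 (f n)) ler_powR // ltW.
apply: (@le_trans _ _ (s * expR 1)); first by rewrite ler_wpM2l // ler_expR.
rewrite -ler_pdivlMr //; apply: (le_trans beats).
by rewrite mulrAC ler_wpM2r ?invr_ge0 ?expR_ge0 // ler_wpM2r // ge_min lexx orbT.
Qed.
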